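(* Let $n\ge 2$. For any partition $\mu$ and composition $\lambda=(\lambda_1,\dots,\lambda_n)\in(\mathbf Z_{\ge0})^n$ such that $|\lambda|=|\mu|$ we have $$\sum_{\eta\,(l(\eta)\le n)}K_{\eta\lambda}K_{\eta\mu}(q)=\sum_{\{\nu\}}q^{\phi(\{\nu\})}\prod_{\substack{1\le a\le n-1\\1\le i\le\mu_1}}\begin{bmatrix}\nu^{(a+1)}_i-\nu^{(a)}_{i+1}\\ \nu^{(a)}_i-\nu^{(a)}_{i+1}\end{bmatrix},$$ $$\phi(\{\nu\})=\sum_{a=0}^{n-1}\sum_{i=1}^{\mu_1}\binom{\nu^{(a+1)}_i-\nu^{(a)}_i}{2},$$ where the sum $\sum_{\{\nu\}}$ runs over the sequences of Young diagrams $\nu^{(1)},\dots,\nu^{(n-1)}$ such that $$\emptyset=:\nu^{(0)}\subset\nu^{(1)}\subset\cdots\subset\nu^{(n-1)}\subset\nu^{(n)}:=\mu',\qquad |\nu^{(a)}|=\lambda_1+\cdots+\lambda_a\quad(1\le a\le n-1).$$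
   Context: $K_{\eta\mu}(q)$ is the Kostka–Foulkes polynomial, defined by $s_\eta(x)=\sum_\mu K_{\eta\mu}(q)P_\mu(x;q)$ with $P_\mu(x;q)$ the Hall–Littlewood polynomial; $K_{\eta\lambda}=K_{\eta\lambda}(1)$ is the Kostka number, extended to compositions $\lambda$ by invariance under permutation of the components of $\lambda$. The sum on the left is over partitions $\eta$ of $|\mu|$ with at most $n$ nonzero parts ($l(\eta)$ is the number of nonzero parts). $\mu'$ is the conjugate partition; $\nu^{(a)}_i$ is the $i$-th part of $\nu^{(a)}$ (zero beyond its length). $\binom x2=x(x-1)/2$. $\begin{bmatrix}m\\k\end{bmatrix}=\frac{(q)_m}{(q)_k(q)_{m-k}}$ if $0\le k\le m$ and $0$ otherwise, where $(q)_m=\prod_{i=1}^m(1-q^i)$. *)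

(* Defs.v *)
From Stdlib Require Import ClassicalEpsilon.
From HB Require Import structures.
From mathcomp Require Import all_boot all_order all_algebra all_fingroup.
From mathcomp Require Import fraction.
From mathcomp Require Import mpoly.

Set Implicit Arguments.
Unset Strict Implicit.
Unset Printing Implicit Defensive.

Import GRing.Theory.

Local Open Scope nat_scope.

(* A partition is the weakly decreasing list of its nonzero parts, so that     *)
(* l(p) is size p; the list is indexed from 0, hence the (i+1)-st part of p is *)
(* part p i.                                                                   *)
Definition is_partition (s : seq nat) : bool := sorted geq s && (0 \notin s).

Record intpart := IntPart {
  parts :> seq nat;
  partsP : is_partition parts
}.

HB.instance Definition _ := [isSub for parts].
HB.instance Definition _ := [Countable of intpart by <:].

Definition part (p : intpart) (i : nat) : nat := nth 0 p i.

Definition weight (p : intpart) : nat := sumn p.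

Definition included (p r : intpart) : bool :=
  [forall i : 'I_(size p), part p i <= part r i].

Definition empty_partition : intpart := @IntPart [::] isT.

Lemma sort_nonzero_is_partition (s : seq nat) :
  is_partition (sort geq (filter (predC1 0) s)).
Proof.
by rewrite /is_partition sort_sorted ?mem_sort ?mem_filter // => a b;
  apply: leq_total.
Qed.

(* The partition obtained by permuting the components of a composition. *)
Definition partition_of (s : seq nat) : intpart :=
  IntPart (sort_nonzero_is_partition s).

Definition conj_parts (s : seq nat) : seq nat :=
  mkseq (fun j => count (fun x => j < x) s) (head 0 s).

Lemma conj_parts_is_partition (s : seq nat) : is_partition (conj_parts s).
Proof.
apply/andP; split.
  apply: (@homo_sorted _ _ _ leq geq _ _ (iota_sorted 0 _)) => i j le_ij.
  by apply: sub_count => x; apply: leq_ltn_trans.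
apply/negP => /mapP[j]; rewrite mem_iota /= add0n.
case: s => [|x s] //= lt_jx.
by rewrite lt_jx.
Qed.

Definition conj_partition (p : intpart) : intpart :=
  IntPart (conj_parts_is_partition p).

(* The finite type of the partitions of weight at most m. *)
Record bounded_partition (m : nat) := BoundedPartition {
  bpart :> intpart;
  bpartP : weight bpart <= m
}.

HB.instance Definition _ (m : nat) := [isSub for @bpart m].
HB.instance Definition _ (m : nat) := [Countable of bounded_partition m by <:].

Section BoundedPartitionFinite.

Variable m : nat.

Definition bpart_code (p : bounded_partition m) : {ffun 'I_m -> 'I_m.+1} :=
  [ffun i : 'I_m => inord (part p i)].

Definition bpart_decode (t : {ffun 'I_m -> 'I_m.+1}) :
    option (bounded_partition m) :=
  obind insub (insub [seq x <- [seq nat_of_ord (t i) | i <- enum 'I_m] | x != 0]).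

Lemma size_le_sumn (s : seq nat) : 0 \notin s -> size s <= sumn s.
Proof.
elim: s => //= x s IHs; rewrite inE negb_or eq_sym -lt0n => /andP[x_gt0 /IHs le_s].
by rewrite -add1n leq_add.
Qed.

Lemma nth_le_sumn (s : seq nat) i : nth 0 s i <= sumn s.
Proof.
elim: s i => [|x s IHs] [|i] //=; first exact: leq_addr.
exact: leq_trans (IHs i) (leq_addl _ _).
Qed.

Lemma bpart_codeK : pcancel bpart_code bpart_decode.
Proof.
case=> -[s s_part] /= s_le; rewrite /bpart_decode.
have /andP[_ s_n0] := s_part.
have size_s : size s <= m by apply: leq_trans (size_le_sumn s_n0) s_le.
set u := map _ _.
have -> : u = s ++ nseq (m - size s) 0.
  apply: (@eq_from_nth _ 0).
    by rewrite size_map size_enum_ord size_cat size_nseq subnKC.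
  move=> i; rewrite size_map size_enum_ord => lt_im.
  rewrite (nth_map (Ordinal lt_im)) ?size_enum_ord // ffunE nth_cat nth_nseq.
  rewrite /part /= nth_enum_ord // inordK; last first.
    by rewrite ltnS (leq_trans (nth_le_sumn _ _)).
  by case: ltnP => // le_si; rewrite nth_default // if_same.
have -> : [seq x <- s ++ nseq (m - size s) 0 | x != 0] = s.
  rewrite filter_cat filter_nseq cats0; apply/all_filterP/allP => x xs.
  by apply: contraNneq s_n0 => <-.
rewrite insubT /= insubT; congr Some; exact: val_inj.
Qed.

End BoundedPartitionFinite.

HB.instance Definition _ (m : nat) : isFinite (bounded_partition m) :=
  PCanIsFinite (@bpart_codeK m).

Local Open Scope ring_scope.

(* Symmetric functions in N variables live in the fraction field of            *)
(* Z[q][x_0, ..., x_(N-1)].                                                    *)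
Definition ratfun (N : nat) := {fraction {mpoly {poly int}[N]}}.

Definition cst (N : nat) (c : {poly int}) : ratfun N :=
  tofrac (mpolyC N c).

Definition var (N : nat) (i : 'I_N) : ratfun N :=
  tofrac ('X_i : {mpoly {poly int}[N]}).

(* Bialternant formula; meaningful for l(p) <= N. *)
Definition schur (N : nat) (p : intpart) : ratfun N :=
  \det (\matrix_(i < N, j < N) var i ^+ (part p j + (N - j.+1))%N) /
  \det (\matrix_(i < N, j < N) var i ^+ (N - j.+1)%N).

(* v_k(q) = \prod_(1 <= i <= k) (1 - q^i) / (1 - q) *)
Definition vpoly (k : nat) : {poly int} :=
  \prod_(1 <= i < k.+1) \sum_(0 <= j < i) 'X^j.

(* Multiplicity of the part i when p is padded with zeros to length N. *)
Definition multiplicity (N : nat) (p : intpart) (i : nat) : nat :=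
  #|[set k : 'I_N | part p k == i]|.

Definition vpart (N : nat) (p : intpart) : {poly int} :=
  \prod_(0 <= i < (part p 0).+1) vpoly (multiplicity N p i).

(* P_p(x_0, ..., x_(N-1); q), as in Macdonald, Symmetric functions and Hall    *)
(* polynomials, III.(2.1)-(2.2); meaningful for l(p) <= N.                     *)
Definition hall_littlewood (N : nat) (p : intpart) : ratfun N :=
  (cst N (vpart N p))^-1 *
  \sum_(w : 'S_N)
    (\prod_(i < N) var (w i) ^+ part p i) *
    \prod_(i < N) \prod_(j < N | (i < j)%N)
      ((var (w i) - cst N 'X * var (w j)) / (var (w i) - var (w j))).

(* The expansion is required for every number of variables N, which is the     *)
(* identity in infinitely many variables; s_eta and P_mu vanish in N variables *)
(* when the length of the index exceeds N.                                     *)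
Definition is_kostka_foulkes (K : intpart -> intpart -> {poly int}) : Prop :=
  (forall eta mu : intpart, weight eta <> weight mu -> K eta mu = 0) /\
  (forall (N : nat) (eta : intpart), (size eta <= N)%N ->
     schur N eta =
     \sum_(mu : bounded_partition (weight eta) |
             (weight mu == weight eta) && (size mu <= N)%N)
       cst N (K eta mu) * hall_littlewood N mu).

Definition kostka_foulkes : intpart -> intpart -> {poly int} :=
  epsilon (inhabits (fun _ _ => 0)) is_kostka_foulkes.

(* The Kostka number of shape p and of weight a composition. *)
Definition kostka (p : intpart) (lam : seq nat) : int :=
  (kostka_foulkes p (partition_of lam)).[1].

Definition qpoch (m : nat) : {poly int} := \prod_(1 <= i < m.+1) (1 - 'X^i).

Definition qbinom (m k : nat) : {fraction {poly int}} :=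
  if (k <= m)%N then tofrac (qpoch m) / (tofrac (qpoch k) * tofrac (qpoch (m - k)))
  else 0.

(* The sequences (nu^(1), ..., nu^(n-1)); the bound on the weights only makes  *)
(* the type finite, the diagrams of interest being included in mu'.            *)
Definition diagrams (n : nat) (mu : intpart) :=
  (n.-1).-tuple (bounded_partition (weight mu)).

(* nu^(a) for 0 <= a <= n, with nu^(0) empty and nu^(n) = mu'. *)
Definition diagram (n : nat) (mu : intpart) (nu : diagrams n mu) (a : nat) :
    intpart :=
  nth empty_partition
    (empty_partition :: rcons (map (@bpart _) nu) (conj_partition mu)) a.

Definition admissible (n : nat) (mu : intpart) (lam : n.-tuple nat)
    (nu : diagrams n mu) : bool :=
  [forall a : 'I_n, included (diagram nu a) (diagram nu a.+1)] &&
  [forall a : 'I_n, (0 < a)%N ==>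
     (weight (diagram nu a) == (\sum_(b < n | (b < a)%N) tnth lam b)%N)].

(* The truncated subtractions here and in the theorem are genuine differences  *)
(* for admissible nu, since nu^(a) is included in nu^(a+1).                    *)
Definition phi (n : nat) (mu : intpart) (nu : diagrams n mu) : nat :=
  (\sum_(0 <= a < n) \sum_(0 <= i < part mu 0)
     'C(part (diagram nu a.+1) i - part (diagram nu a) i, 2))%N.

(* Main.v *)
(* Let h_lam be the product of the complete symmetric functions h_(lam_i). Both *)
(* sides are the coefficient of P_mu(x; q) in h_lam.                            *)
(* Right-hand side: iterate the Pieri rule                                      *)
(*   h_r P_nu = \sum_kappa q^(\sum_i C(kappa'_i - nu'_i, 2))                    *)
(*      \prod_i [kappa'_i - nu'_(i+1), nu'_i - nu'_(i+1)] P_kappa.               *)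
(* The Pieri rule for e_r follows from the symmetrization formula for P: modulo *)
(* symmetrization, x_(i+1) f = q x_i f when f is symmetric in x_i and x_(i+1).  *)
(* The rule for h_r follows by inverting \sum_k (-1)^k e_k h_(r-k) = 0, since   *)
(* the composed coefficients factor over the columns and the last column where  *)
(* the diagrams differ contributes a vanishing alternating q-binomial sum.      *)
(* Left-hand side: Jacobi-Trudi gives s_eta = \sum_alpha J_(eta alpha) h_alpha  *)
(* with alpha = eta + delta - w(delta), so the matrices satisfy K(q) = J A(q)   *)
(* where h_alpha = \sum_mu A_(alpha mu) P_mu (in particular K has coefficients  *)
(* in Z[q]). Comparing the coefficients of x^(eta' + delta) in                  *)
(* a_delta s_eta = a_(eta + delta) at q = 1 gives K(1) J^T = 1. Hence           *)
(* K(1)^T J = 1 and K(1)^T K(q) = A(q).                                         *)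

Require Import Defs.
From HB Require Import structures.
From mathcomp Require Import all_boot all_order all_algebra all_fingroup.
From mathcomp Require Import fraction.
From mathcomp Require Import mpoly.
From mathcomp Require Import ring zify.

Set Implicit Arguments.
Unset Strict Implicit.
Unset Printing Implicit Defensive.

Import GRing.Theory.

Local Open Scope ring_scope.

(** * q-binomial coefficients *)

(** Both sides compute the coefficient of $P_\mu(x;q)$ in $h_\lambda=\prod_i h_{\lambda_i}$, which
    is called [fermionic]. On the left, $h_\lambda=\sum_\eta K_{\eta\lambda}s_\eta$, where only
    $l(\eta)\le n$ occurs, and each $s_\eta$ is expanded in the $P_\mu$. On the right, the Pieri
    rule is applied once per factor, starting from $P_\emptyset=1$; the chain $\nu$ records the
    conjugates of the successive indices.

    Pieri rule. Under the symmetrization that defines $P$, moving a variable one place costs a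
    factor $q$ ([sym_straighten]). On a block of equal exponents this turns $\prod(1+tx_l)$ into
    $q$-binomials ([sym_block]); working column by column and normalizing gives the rule for $e_r$
    ([elem_hlP]). The proposed coefficients for $h_r$ invert those for $e_r$
    ([hstrip_vstrip_inversion]), and the generating series of the $h_r$ and of the $(-1)^re_r$ are
    inverse too, whence [hlP_pieri] and its iteration [hsymm_prod].

    Left-hand side. Jacobi-Trudi writes $s_\eta$ through products of the $h_r$, hence through the
    $P_\mu$. This gives the existence of the Kostka-Foulkes polynomials and, by
    [hall_littlewood_free], the formula $K(q)=JA(q)$ ([kostka_foulkes_jt]). At $q=1$ the $P_\mu$
    become monomial symmetric functions, and $K(1)J^T=1$ ([kostka_jt_matrix]). The matrices are
    square, so $J^TK(1)=1$ as well, and $K(1)^TK(q)=A(q)$ is [sum_kostka].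

    Finally [fermionic_flags] unrolls the iterated Pieri rule into a sum over chains,
    [flag_steps_admissible] shows that only admissible chains survive, and [admissible_flag_steps]
    evaluates them. *)

Section QAnalogues.

Variables (R : comNzRingType) (q : R).

Definition qint (n : nat) : R := \sum_(0 <= j < n) q ^+ j.

Definition qfact (n : nat) : R := \prod_(1 <= i < n.+1) qint i.

(** The $q$-Pascal recursion keeps the Gaussian binomial inside any commutative ring, so that it
    commutes with ring morphisms. The subtraction [m' - k'] is truncated only where [gauss m' k'] is
    0. *)
Fixpoint gauss (m k : nat) : R :=
  match m, k with
  | _, 0 => 1
  | 0, _.+1 => 0
  | m'.+1, k'.+1 => gauss m' k'.+1 + q ^+ (m' - k') * gauss m' k'
  end.

Lemma qint0 : qint 0 = 0.
Proof. by rewrite /qint big_geq. Qed.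

Lemma qintD m n : qint (m + n) = qint m + q ^+ m * qint n.
Proof.
elim: n => [|n IHn]; first by rewrite qint0 addn0 mulr0 addr0.
by rewrite addnS /qint !big_nat_recr //= -!/(qint _) IHn exprD; ring.
Qed.

Lemma qintS n : qint n.+1 = qint n + q ^+ n.
Proof. by rewrite /qint big_nat_recr. Qed.

Lemma qint_geom n : (1 - q) * qint n = 1 - q ^+ n.
Proof.
elim: n => [|n IHn]; first by rewrite qint0 mulr0 expr0 subrr.
by rewrite qintS mulrDr IHn exprS; ring.
Qed.

Lemma qfact0 : qfact 0 = 1.
Proof. by rewrite /qfact big_geq. Qed.

Lemma qfactS n : qfact n.+1 = qfact n * qint n.+1.
Proof. by rewrite /qfact big_nat_recr. Qed.

Lemma gauss0 m : gauss m 0 = 1.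
Proof. by case: m. Qed.

Lemma gaussS m k : gauss m.+1 k.+1 = gauss m k.+1 + q ^+ (m - k) * gauss m k.
Proof. by []. Qed.

Lemma gauss_small m k : (m < k)%N -> gauss m k = 0.
Proof.
elim: m k => [|m IHm] [|k] //= lt_mk.
by rewrite !IHm ?mulr0 ?addr0 // ltnW.
Qed.

Lemma gaussnn m : gauss m m = 1.
Proof.
by elim: m => //= m IHm; rewrite IHm gauss_small // subnn mulr1 add0r.
Qed.

Lemma gauss_qfact k l : gauss (k + l) k * qfact k * qfact l = qfact (k + l).
Proof.
elim: k l => [|k IHk] l; first by rewrite gauss0 qfact0 !mul1r.
elim: l => [|l IHl]; first by rewrite addn0 gaussnn qfact0 mul1r mulr1.
rewrite addSn addnS gaussS subSn ?leq_addr // addKn.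
move: IHl (IHk l.+1); rewrite addSn addnS => eq1 eq2.
rewrite (qfactS (k + l).+1).
have -> : (k + l).+2 = (l.+1 + k.+1)%N by lia.
rewrite (qintD l.+1 k.+1) mulrDr -{1}eq1 mulrCA -eq2.
by rewrite !qfactS; ring.
Qed.

(** By $q$-Pascal the sum for [E.+1] is $1-q^E$ times the sum for [E], and this factor vanishes at
    [E = 0]. *)
Lemma gauss_alternating D :
  \sum_(0 <= d < D.+1) (-1) ^+ d * q ^+ 'C(d, 2) * gauss D d = (D == 0%N)%:R.
Proof.
case: D => [|D]; first by rewrite big_nat1 /= !mulr1.
have rec E : \sum_(0 <= d < E.+2) (-1) ^+ d * q ^+ 'C(d, 2) * gauss E.+1 d =
    (1 - q ^+ E) * \sum_(0 <= d < E.+1) (-1) ^+ d * q ^+ 'C(d, 2) * gauss E d.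
  rewrite big_nat_recl //= [in RHS]mulrBl [in RHS]mul1r.
  under eq_bigr do rewrite mulrDr; rewrite big_split /= addrA.
  congr (_ + _).
    rewrite big_nat_recr //= (gauss_small (leqnn E.+1)) mulr0 addr0.
    by rewrite [in RHS]big_nat_recl //= gauss0.
  rewrite mulr_sumr -sumrN !big_nat; apply: eq_bigr => d /andP[_ lt_dE].
  rewrite binS bin1 exprD exprS -(subnK (_ : d <= E)%N) // exprD subnK //.
  by ring.
elim: D => [|D IHD]; first by rewrite rec expr0 subrr mul0r.
by rewrite rec IHD mulr0.
Qed.

End QAnalogues.

Section QAnaloguesField.

Variables (F : fieldType) (q : F).
Hypothesis qfact_neq0 : forall n, qfact q n != 0.

Lemma gaussE k l : gauss q (k + l) k = qfact q (k + l) / (qfact q k * qfact q l).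
Proof. by rewrite -gauss_qfact; field; rewrite !qfact_neq0. Qed.

(** Both products are the $q$-trinomial $[M+D]!/([M]!\,[d]!\,[D-d]!)$. *)
Lemma gauss_trinomial M D d : (d <= D)%N ->
  gauss q (M + d) M * gauss q (M + D) (D - d) = gauss q (M + D) D * gauss q D d.
Proof.
move=> le_dD; have E : D = (d + (D - d))%N by rewrite subnKC.
move: (D - d)%N E => e ->.
have E1 := gaussE M d; have E2 := gaussE e (M + d).
have E3 := gaussE (d + e) M; have E4 := gaussE d e.
rewrite E1 E4 (_ : (M + (d + e) = e + (M + d))%N) ?E2; last by lia.
rewrite (_ : (e + (M + d) = d + e + M)%N) ?E3; last by lia.
by field; rewrite !qfact_neq0.
Qed.

(** The inversion of the two Pieri rules in a single column: [a], [b], [c] are the lengths of that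
    column in three nested diagrams and [h] is the common length of the next column. With $d=b-a$,
    [gauss_trinomial] extracts a factor free of $b$ and leaves the alternating sum of
    [gauss_alternating]. *)
Lemma gauss_inversion h a c K : (h <= a)%N -> (h <= c)%N -> (c <= K)%N ->
  \sum_(0 <= b < K.+1)
    (-1) ^+ (b + c) *
    ((if (a <= b)%N then q ^+ 'C(b - a, 2) * gauss q (b - h) (a - h) else 0) *
     (if (b <= c)%N then gauss q (c - h) (c - b) else 0)) = (a == c)%:R.
Proof.
move=> le_ha le_hc le_cK.
rewrite (@big_cat_nat _ _ _ c.+1) //= [X in _ + X]big1_seq ?addr0; last first.
  by move=> b /andP[_]; rewrite mem_index_iota ltnNge => /andP[/negPf-> _];
     rewrite !mulr0.
have [lt_ca | le_ac] := ltnP c a.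
  rewrite big1_seq ?gtn_eqF // => b /andP[_]; rewrite mem_index_iota ltnS => /= le_bc.
  by rewrite leqNgt (leq_ltn_trans le_bc lt_ca) /= mul0r mulr0.
rewrite (@big_cat_nat _ _ _ a) //=; last by rewrite ltnW.
rewrite [X in X + _]big1_seq ?add0r; last first.
  move=> b /andP[_]; rewrite mem_index_iota => /andP[_ lt_ba].
  by rewrite leqNgt lt_ba mul0r mulr0.
rewrite -{1}[a]add0n big_addn subSn //.
set D := (c - a)%N; set M := (a - h)%N.
transitivity ((-1) ^+ D * gauss q (M + D) D *
   \sum_(0 <= d < D.+1) (-1) ^+ d * q ^+ 'C(d, 2) * gauss q D d).
  rewrite mulr_sumr !big_nat; apply: eq_bigr => d /andP[_]; rewrite ltnS => le_d.
  have le_dac : (d + a <= c)%N by lia.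
  rewrite leq_addl le_dac addnK.
  have -> : (d + a - h = M + d)%N by lia.
  have -> : (c - h = M + D)%N by lia.
  have -> : (c - (d + a) = D - d)%N by lia.
  have -> : (d + a + c = d + D + a.*2)%N by lia.
  have -> : (-1) ^+ (d + D + a.*2) = (-1) ^+ d * (-1) ^+ D :> F.
    by rewrite -signr_odd oddD odd_double addbF signr_odd exprD.
  rewrite -[_ * _ * gauss q D d]mulrA.
  have := gauss_trinomial M le_d; set g1 := gauss _ _ _; set g2 := gauss _ _ _.
  set g3 := gauss _ _ _; set g4 := gauss _ _ _ => E.
  transitivity ((-1) ^+ d * (-1) ^+ D * q ^+ 'C(d, 2) * (g1 * g2)); first by ring.
  by rewrite E; ring.
rewrite gauss_alternating subn_eq0.
have [le_ca | lt_ac] := leqP c a.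
  have -> : c = a by lia.
  by rewrite /D (_ : c - a = 0)%N ?gauss0 ?eqxx ?expr0 ?mulr1 //; lia.
by rewrite mulr0 ltn_eqF.
Qed.

End QAnaloguesField.

(** * Symmetrization and the Pieri rules *)

(* Diagrams are encoded by the list of their column lengths, padded with zeros *)
(* to a fixed width W; K bounds the number of rows.                            *)
Fixpoint cols (W K : nat) : seq (seq nat) :=
  if W is W'.+1 then
    flatten [seq [seq k :: c | c <- cols W' k] | k <- index_iota 0 K.+1]
  else [:: [::]].

Lemma mem_cols W K c : (c \in cols W K) = (size c == W) && path geq K c.
Proof.
elim: W K c => [|W IHW] K c; first by rewrite inE; case: c.
apply/flatten_mapP/andP => [[k] | []].
  rewrite mem_index_iota ltnS /= => le_kK /mapP[c']; rewrite IHW.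
  by move=> /andP[/eqP size_c' path_c'] ->; rewrite /= size_c' eqxx le_kK.
case: c => //= k c; rewrite eqSS => size_c /andP[le_kK path_c].
exists k; first by rewrite mem_index_iota ltnS.
by apply/mapP; exists c; rewrite // IHW size_c.
Qed.

Lemma cols_uniq W K : uniq (cols W K).
Proof.
elim: W K => [//|W IHW] K; rewrite /cols -/cols.
have : uniq (index_iota 0 K.+1) by apply: iota_uniq.
elim: (index_iota 0 K.+1) => [//|k s IHs] /= /andP[k_s /IHs uniq_s]; rewrite cat_uniq uniq_s andbT.
rewrite map_inj_uniq ?IHW /=; last by move=> c c' [].
apply/hasPn => c /flatten_mapP[k' k'_s /mapP[c' _ ->]].
by apply: contra k_s => /mapP[c'' _ [<- _]].
Qed.

Section ColsSum.

Variable R : nmodType.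

Lemma big_colsS W K (f : seq nat -> R) :
  \sum_(c <- cols W.+1 K) f c =
  \sum_(0 <= k < K.+1) \sum_(c <- cols W k) f (k :: c).
Proof. by rewrite big_flatten big_map; apply: eq_bigr => k _; rewrite big_map. Qed.

Lemma big_cols_narrow W h K (f : seq nat -> R) : (h <= K)%N ->
  (forall c, size c = W -> (h < head 0%N c)%N -> f c = 0) ->
  \sum_(c <- cols W K) f c = \sum_(c <- cols W h) f c.
Proof.
case: W => [|W] le_hK f0; first by rewrite !big_seq1.
rewrite !big_colsS (@big_cat_nat _ _ _ h.+1) //= [X in _ + X]big1_seq ?addr0 //.
move=> k /=; rewrite mem_index_iota => /andP[lt_hk _]; apply: big1_seq => c /=.
by rewrite mem_cols => /andP[/eqP size_c _]; apply: f0; rewrite /= ?size_c.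
Qed.

End ColsSum.

Section Symmetrization.

Variables (R : comNzRingType) (q t : R) (N : nat) (x : 'I_N -> R) (D : 'S_N -> R).

Definition symmetrize (g : 'S_N -> R) : R := \sum_w g w * D w.

(** Positions are natural numbers, with value 0 from [N] on, so that products over ranges of
    positions can be cut and shifted freely. *)
Definition xat (w : 'S_N) (k : nat) : R := if insub k is Some i then x (w i) else 0.

(** The monomial $w(x^\kappa)$, where $\kappa$ has column lengths [c]; [sym_strip] consumes it one
    column at a time. *)
Definition mono (c : seq nat) (w : 'S_N) : R :=
  \prod_(k <- c) \prod_(0 <= l < k) xat w l.

Definition swap_invariant (g : 'S_N -> R) (k : nat) : Prop :=
  forall i j : 'I_N, i = k :> nat -> j = k.+1 :> nat ->
  forall w, g (tperm i j * w)%g = g w.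

Lemma sym_ext g1 g2 : g1 =1 g2 -> symmetrize g1 = symmetrize g2.
Proof. by move=> eq_g; apply: eq_bigr => w _; rewrite eq_g. Qed.

Lemma symD g1 g2 : symmetrize (fun w => g1 w + g2 w) = symmetrize g1 + symmetrize g2.
Proof. by rewrite -big_split; apply: eq_bigr => w _; rewrite mulrDl. Qed.

Lemma symZ a g : symmetrize (fun w => a * g w) = a * symmetrize g.
Proof. by rewrite mulr_sumr; apply: eq_bigr => w _; rewrite mulrA. Qed.

Lemma xat_ord w (i : 'I_N) : xat w i = x (w i).
Proof. by rewrite /xat valK. Qed.

Lemma xat_swap (i j : 'I_N) k w l : i = k :> nat -> j = k.+1 :> nat ->
  xat (tperm i j * w) l =
  xat w (if l == k then k.+1 else if l == k.+1 then k else l).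
Proof.
move=> ik jk; have [lt_lN | le_Nl] := ltnP l N; last first.
  have lt_kl : (k.+1 < l)%N by rewrite -jk (leq_trans (ltn_ord j)).
  by rewrite !gtn_eqF ?(ltnW lt_kl) // /xat insubF // ltnNge le_Nl.
rewrite -[l]/(val (Ordinal lt_lN)) xat_ord permM; set o := Ordinal _.
have [/= lk | /= nlk] := eqVneq (l : nat) k.
  by rewrite (_ : o = i) ?tpermL -?jk ?xat_ord //; apply/val_inj; rewrite /= lk.
have [/= lk' | /= nlk'] := eqVneq (l : nat) k.+1.
  by rewrite (_ : o = j) ?tpermR -?ik ?xat_ord //; apply/val_inj; rewrite /= lk'.
rewrite tpermD -?[l]/(val o) ?xat_ord //.
  by apply: contra_neq nlk => io; rewrite -ik io.
by apply: contra_neq nlk' => jo; rewrite -jk jo.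
Qed.

Lemma swap_invariantM g1 g2 k : swap_invariant g1 k -> swap_invariant g2 k ->
  swap_invariant (fun w => g1 w * g2 w) k.
Proof. by move=> inv1 inv2 i j ik jk w; rewrite (inv1 i j) // (inv2 i j). Qed.

Lemma swap_invariant_xat (f : R -> R) l k : l != k -> l != k.+1 ->
  swap_invariant (fun w => f (xat w l)) k.
Proof.
by move=> lk lk' i j ik jk w; rewrite (xat_swap w l ik jk) (negPf lk) (negPf lk').
Qed.

Lemma swap_invariant_range (f : R -> R) u v k :
  [|| (k.+1 < u)%N, (v <= k)%N | (u <= k)%N && (k.+1 < v)%N] ->
  swap_invariant (fun w => \prod_(u <= l < v) f (xat w l)) k.
Proof.
have out u' v' : (k.+1 < u')%N || (v' <= k)%N ->
    swap_invariant (fun w => \prod_(u' <= l < v') f (xat w l)) k.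
  move=> uvk i j ik jk w; rewrite !big_nat; apply: eq_bigr => l uvl.
  rewrite (xat_swap w l ik jk) !ifN //; first by apply/eqP => E; lia.
  by apply/eqP => E; lia.
case/or3P => [lt_ku | le_vk | /andP[le_uk lt_kv] i j ik jk w].
- by apply: out; rewrite lt_ku.
- by apply: out; rewrite le_vk orbT.
have split_prod z : \prod_(u <= l < v) f (xat z l) =
    \prod_(u <= l < k) f (xat z l) * (f (xat z k) * f (xat z k.+1)) *
    \prod_(k.+2 <= l < v) f (xat z l).
  rewrite (@big_cat_nat _ _ _ k) //=; last by rewrite ltnW // ltnW.
  rewrite (@big_ltn _ _ _ k) ?(ltnW lt_kv) // (@big_ltn _ _ _ k.+1) //.
  by rewrite !mulrA.
rewrite !split_prod (out u k _ i j) ?leqnn ?orbT //.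
rewrite (out k.+2 v _ i j) ?leqnn //.
rewrite !(xat_swap _ _ ik jk) eqxx gtn_eqF // eqxx.
by rewrite (mulrC (f (xat w k.+1))).
Qed.

Lemma swap_invariant_mono c k : all (fun p => (p <= k)%N) c ->
  swap_invariant (mono c) k.
Proof.
rewrite /mono; elim: c => [_ i j _ _ w|p c IHc /andP[le_pk /IHc inv_c] i j ik jk w].
  by rewrite !big_nil.
rewrite !big_cons (inv_c i j) // (@swap_invariant_range id 0 p k _ i j) //.
by rewrite le_pk orbT.
Qed.

(** The kernel enters only through [D_swap], and the coefficients form a ring, so that the results
    apply over [{poly F}] with [t] built from the indeterminate. *)
Hypothesis two_regular : forall a : R, a + a = 0 -> a = 0.
Hypothesis D_swap : forall (w : 'S_N) (i j : 'I_N), j = i.+1 :> nat ->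
  (x (w j) - q * x (w i)) * D w =
  - ((x (w i) - q * x (w j)) * D (tperm i j * w)%g).

(* The difference of the two sides is its own opposite under w -> s_k w. *)
Lemma sym_straighten g k : swap_invariant g k -> (k.+1 < N)%N ->
  symmetrize (fun w => g w * xat w k.+1) = q * symmetrize (fun w => g w * xat w k).
Proof.
move=> g_inv lt_kN; pose j := Ordinal lt_kN; pose i := Ordinal (ltnW lt_kN).
have xj w : xat w k.+1 = x (w j) by rewrite -[k.+1]/(val j) xat_ord.
have xi w : xat w k = x (w i) by rewrite -[k]/(val i) xat_ord.
apply/eqP; rewrite -subr_eq0; apply/eqP/two_regular; set S := _ - _.
have SE : S = \sum_w g w * ((x (w j) - q * x (w i)) * D w).
  rewrite /S /symmetrize mulr_sumr -sumrB; apply: eq_bigr => w _.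
  by rewrite xi xj; ring.
have SN : S = - \sum_w g w * ((x (w j) - q * x (w i)) * D w).
  rewrite SE [LHS](reindex_inj (mulgI (tperm i j))) -sumrN; apply: eq_bigr => w _.
  rewrite (g_inv i j) // !permM tpermL tpermR (@D_swap w i j) //.
  by rewrite mulrN opprK.
by rewrite {1}SE SN subrr.
Qed.

Lemma sym_move g a d : (forall k, (a <= k < a + d)%N -> swap_invariant g k) ->
  (a + d < N)%N ->
  symmetrize (fun w => g w * xat w (a + d)) = q ^+ d * symmetrize (fun w => g w * xat w a).
Proof.
elim: d => [|d IHd] g_inv lt_N; first by rewrite addn0 mul1r.
rewrite addnS sym_straighten; [|by apply: g_inv; lia|by rewrite -addnS].
rewrite IHd ?exprS ?mulrA //; last by lia.
by move=> k k_range; apply: g_inv; lia.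
Qed.

(** Induction on [m], with the last factor absorbed into [g]. Its variable at position [u + m]
    slides down to [u + s], the first position free after the product of the other [s] variables,
    which costs $q^{m-s}$: this is the $q$-Pascal recursion. *)
Lemma sym_block g u m :
  (forall k, (u <= k)%N -> (k.+1 < u + m)%N -> swap_invariant g k) ->
  (u + m <= N)%N ->
  symmetrize (fun w => g w * \prod_(u <= l < u + m) (1 + t * xat w l)) =
  \sum_(0 <= s < m.+1) t ^+ s * gauss q m s *
    symmetrize (fun w => g w * \prod_(u <= l < u + s) xat w l).
Proof.
elim: m g => [|m IHm] g g_inv le_N.
  rewrite big_nat1 !mul1r addn0; apply: sym_ext => w.
  by rewrite !big_geq.
pose Y s := symmetrize (fun w => g w * \prod_(u <= l < u + s) xat w l).
transitivity (\sum_(0 <= s < m.+1)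
    (t ^+ s * gauss q m s * Y s + t ^+ s.+1 * (q ^+ (m - s) * gauss q m s) * Y s.+1)).
  transitivity (symmetrize (fun w => g w * (1 + t * xat w (u + m)) *
      \prod_(u <= l < u + m) (1 + t * xat w l))).
    apply: sym_ext => w; rewrite addnS big_nat_recr ?leq_addr //=.
    by rewrite -mulrA (mulrC (1 + _)).
  rewrite IHm; [|move=> k le_uk lt_k|by lia]; last first.
    apply: swap_invariantM; first by apply: g_inv => //; lia.
    by apply: (@swap_invariant_xat (fun y => 1 + t * y)); lia.
  rewrite !big_nat; apply: eq_bigr => s /andP[_]; rewrite ltnS => le_sm.
  have -> : symmetrize (fun w => g w * (1 + t * xat w (u + m)) *
      \prod_(u <= l < u + s) xat w l) = Y s + t * (q ^+ (m - s) * Y s.+1).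
    transitivity (Y s + t * symmetrize (fun w =>
        g w * \prod_(u <= l < u + s) xat w l * xat w (u + s + (m - s)))).
      rewrite -symZ -symD; apply: sym_ext => w.
      by rewrite (_ : (u + s + (m - s) = u + m)%N); [ring | lia].
    rewrite sym_move; [|move=> k k_range|by lia]; last first.
      apply: swap_invariantM; first by apply: g_inv; lia.
      by apply: (@swap_invariant_range id); lia.
    congr (_ + _ * (_ * _)); apply: sym_ext => w.
    by rewrite addnS big_nat_recr ?leq_addr //= mulrA.
  by rewrite exprS; ring.
rewrite big_split /= [in RHS]big_nat_recl //= !mul1r.
under [X in _ = _ + X]eq_bigr do rewrite mulrDr mulrDl.
rewrite [in RHS]big_split /= addrA; congr (_ + _).
rewrite [in LHS]big_nat_recl //= gauss0 !mul1r.
by rewrite [in RHS]big_nat_recr //= (gauss_small _ (ltnSn m)) mulr0 mul0r addr0.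
Qed.

(** The coefficient for $e_r$ before normalization. [M] is the column of the smaller diagram
    preceding [h], so positions [h] to [M - 1] form a block of equal exponents, of which [k - h]
    receive a box. *)
Fixpoint estrip (M : nat) (b c : seq nat) : R :=
  match b, c with
  | h :: b', k :: c' =>
      (if (h <= k)%N then t ^+ (k - h) * gauss q (M - h) (k - h) else 0) *
      estrip h b' c'
  | _, _ => 1
  end.

Lemma estrip_wide M b c : (head 0%N b <= M)%N -> (M < head 0%N c)%N ->
  size c = size b -> estrip M b c = 0.
Proof.
case: b c => [|h b] [|k c] //= le_hM lt_Mk _.
by case: leqP => // le_hk; rewrite ?mul0r // gauss_small ?mulr0 ?mul0r //; lia.
Qed.

(** Induction on the columns. The product is cut at [h]: [sym_block] handles positions [h] to
    [M - 1], and the new column goes into [g], which stays symmetric in the positions below [h]. The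
    condition on [last] ensures that no factor is left after the last column. *)
Lemma sym_strip b M g : path geq M b -> last M b = 0%N -> (M <= N)%N ->
  (forall k, (k.+1 < M)%N -> swap_invariant g k) ->
  symmetrize (fun w => g w * mono b w * \prod_(0 <= l < M) (1 + t * xat w l)) =
  \sum_(c <- cols (size b) M) estrip M b c * symmetrize (fun w => g w * mono c w).
Proof.
elim: b M g => [|h b IHb] M g /=.
  move=> _ -> _ _; rewrite big_seq1 mul1r; apply: sym_ext => w.
  by rewrite big_geq // mulr1.
move=> /andP[/= le_hM path_b] last_b le_MN g_inv.
have b_le_h : all (geq h) b.
  by apply: order_path_min path_b => a1 a2 a3 /= ? ?; lia.
rewrite big_colsS (@big_cat_nat _ _ _ h) //=; last by lia.
rewrite [X in X + _]big1_seq ?add0r; last first.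
  move=> k; rewrite mem_index_iota => /andP[_ /andP[_ lt_kh]].
  by apply: big1 => c _; rewrite leqNgt lt_kh !mul0r.
have shift (G : nat -> R) :
    \sum_(h <= i < M.+1) G i = \sum_(0 <= i < (M - h).+1) G (i + h)%N.
  by rewrite -[X in index_iota X _]add0n big_addn subSn.
rewrite shift.
pose g1 w := g w * mono (h :: b) w * \prod_(0 <= l < h) (1 + t * xat w l).
transitivity (symmetrize (fun w => g1 w * \prod_(h <= l < h + (M - h)) (1 + t * xat w l))).
  apply: sym_ext => w; rewrite subnKC // (@big_cat_nat _ _ _ h) //=.
  by rewrite /g1 !mulrA.
rewrite sym_block ?subnKC // => [|k le_hk lt_k]; last first.
  apply: swap_invariantM; last first.
    by apply: (@swap_invariant_range (fun y => 1 + t * y)); rewrite le_hk orbT.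
  apply: swap_invariantM; first exact: g_inv.
  apply: swap_invariant_mono; rewrite /= le_hk.
  by apply: sub_all b_le_h => p /= le_ph; apply: leq_trans le_ph le_hk.
apply: eq_bigr => s _.
pose g2 w := g w * \prod_(0 <= l < s + h) xat w l.
transitivity (t ^+ s * gauss q (M - h) s *
  symmetrize (fun w => g2 w * mono b w * \prod_(0 <= l < h) (1 + t * xat w l))).
  congr (_ * _); apply: sym_ext => w.
  rewrite /g1 /g2 /mono big_cons (@big_cat_nat _ _ _ h 0 (s + h)) ?leq_addl //=.
  by rewrite (addnC s h); ring.
rewrite IHb //; [|by lia|move=> k lt_kh]; last first.
  apply: swap_invariantM; first by apply: g_inv; lia.
  by apply: (@swap_invariant_range id); lia.
rewrite mulr_sumr leq_addl addnK.
(* Raising the bound on the next column from [h] to [s + h] only adds terms whose coefficient is 0,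
   by [estrip_wide]. *)
rewrite [RHS](@big_cols_narrow _ _ h) ?leq_addl //; last first.
  move=> c size_c lt_hc.
  rewrite estrip_wide ?mulr0 ?mul0r //.
  by case: (b) path_b => //= b1 b' /andP[].
apply: eq_bigr => c _; rewrite !mulrA; congr (_ * _); apply: sym_ext => w.
by rewrite /mono big_cons mulrA.
Qed.

Lemma symmetrize_elem b : path geq N b -> last N b = 0%N ->
  (\prod_(i < N) (1 + t * x i)) * symmetrize (mono b) =
  \sum_(c <- cols (size b) N) estrip N b c * symmetrize (mono c).
Proof.
move=> path_b last_b; rewrite -symZ.
have E := @sym_strip b N (fun=> 1) path_b last_b (leqnn N)
  (fun k _ i j _ _ w => erefl).
transitivity (symmetrize (fun w =>
    1 * mono b w * \prod_(0 <= l < N) (1 + t * xat w l))).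
  apply: sym_ext => w; rewrite mul1r mulrC; congr (_ * _).
  rewrite big_mkord (reindex_inj (@perm_inj _ w)).
  by apply: eq_bigr => i _; rewrite xat_ord.
rewrite E; apply: eq_bigr => c _; congr (_ * _).
by apply: sym_ext => w; rewrite mul1r.
Qed.

End Symmetrization.

(* Coefficients of the Pieri rules for P: vstrip for e_r (up to the sign       *)
(* carried by t), hstrip for h_r. They vanish unless b, resp. a, is contained  *)
(* in c.                                                                       *)
Section StripCoefficients.

Variables (R : comNzRingType) (q t : R).

Fixpoint vstrip (b c : seq nat) : R :=
  match b, c with
  | h :: b', k :: c' =>
      (if (h <= k)%N then t ^+ (k - h) * gauss q (k - head 0%N c') (k - h) else 0) *
      vstrip b' c'
  | _, _ => 1
  end.

Fixpoint hstrip (a c : seq nat) : R :=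
  match a, c with
  | h :: a', k :: c' =>
      (if (h <= k)%N then
         q ^+ 'C(k - h, 2) * gauss q (k - head 0%N a') (h - head 0%N a') else 0) *
      hstrip a' c'
  | _, _ => 1
  end.

(** The normalization $v_\kappa(q)$ in terms of column lengths: with [M] the number of variables,
    the successive differences are the multiplicities of the parts $0,1,2,\dots$. The final factor
    is 1 when the list ends in 0. *)
Fixpoint vlist (M : nat) (c : seq nat) : R :=
  if c is k :: c' then qfact q (M - k) * vlist k c' else qfact q M.

Lemma hstrip_sumn a c : size a = size c -> hstrip a c != 0 -> (sumn a <= sumn c)%N.
Proof.
elim: a c => [|h a IHa] [|k c] //= [size_ac].
case: leqP => [le_hk|]; last by rewrite mul0r eqxx.
by move=> nz; apply: leq_add => //; apply: IHa => //;
  apply: contra_neq nz => ->; rewrite mulr0.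
Qed.

Lemma vstrip_sumn b c : size b = size c -> vstrip b c != 0 -> (sumn b <= sumn c)%N.
Proof.
elim: b c => [|h a IHa] [|k c] //= [size_ac].
case: leqP => [le_hk|]; last by rewrite mul0r eqxx.
by move=> nz; apply: leq_add => //; apply: IHa => //;
  apply: contra_neq nz => ->; rewrite mulr0.
Qed.

Lemma estrip_sumn M b c : size b = size c -> estrip q t M b c != 0 ->
  (sumn b <= sumn c)%N.
Proof.
elim: b M c => [|h a IHa] M [|k c] //= [size_ac].
case: leqP => [le_hk|]; last by rewrite mul0r eqxx.
by move=> nz; apply: leq_add => //; apply: (IHa h) => //;
  apply: contra_neq nz => ->; rewrite mulr0.
Qed.

Lemma hstripnn a : hstrip a a = 1.
Proof.
elim: a => //= h a ->.
by rewrite leqnn subnn bin0n expr0 gaussnn !mulr1.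
Qed.

Lemma hstrip_eq_sumn a c : size a = size c -> sumn a = sumn c ->
  hstrip a c = (a == c)%:R.
Proof.
move=> size_ac sum_ac; have [->|] := eqVneq a c; first exact: hstripnn.
apply: contraNeq; elim: a c size_ac sum_ac => [|h a IHa] [|k c] //= [size_ac] sum_ac.
case: leqP => [le_hk|]; last by rewrite mul0r eqxx.
move=> nz; have nz' : hstrip a c != 0 by apply: contra_neq nz => ->; rewrite mulr0.
have le_ac := hstrip_sumn size_ac nz'.
have -> : h = k by lia.
rewrite eqseq_cons eqxx IHa //; lia.
Qed.

End StripCoefficients.

Lemma rmorph_gauss (R S : comNzRingType) (f : {rmorphism R -> S}) (q : R) m k :
  f (gauss q m k) = gauss (f q) m k.
Proof.
elim: m k => [|m IHm] [|k] /=; rewrite ?rmorph0 ?rmorph1 //.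
by rewrite rmorphD rmorphM rmorphXn !IHm.
Qed.

Lemma rmorph_qfact (R S : comNzRingType) (f : {rmorphism R -> S}) (q : R) n :
  f (qfact q n) = qfact (f q) n.
Proof.
rewrite /qfact rmorph_prod; apply: eq_bigr => i _.
by rewrite /qint rmorph_sum; apply: eq_bigr => j _; rewrite rmorphXn.
Qed.

Lemma rmorph_hstrip (R S : comNzRingType) (f : {rmorphism R -> S}) (q : R) a c :
  f (hstrip q a c) = hstrip (f q) a c.
Proof.
elim: a c => [|h a IHa] [|k c] /=; rewrite ?rmorph1 // rmorphM IHa.
by case: leqP => _; rewrite ?rmorph0 // rmorphM rmorphXn rmorph_gauss.
Qed.

(** The coefficient is homogeneous in [t] of degree $|c|-|b|$, so extracting a coefficient in $t$
    isolates a single $e_r$. *)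
Lemma estrip_polyC (F : comNzRingType) (q : F) M b c : size b = size c ->
  estrip q%:P (- 'X) M b c = (estrip q (-1) M b c)%:P * 'X^(sumn c - sumn b).
Proof.
elim: b M c => [|h b IHb] M [|k c] //= size_bc; first by rewrite mulr1.
case: size_bc => size_bc; rewrite IHb //.
case: leqP => [le_hk | _]; last by rewrite !mul0r.
have [-> | nz] := eqVneq (estrip q (-1) h b c) 0.
  by rewrite mulr0 !mul0r mulr0.
have le_bc := estrip_sumn size_bc nz.
have -> : (k + sumn c - (h + sumn b) = (k - h) + (sumn c - sumn b))%N by lia.
rewrite exprD !polyCM -(rmorph_gauss polyC) polyC_exp polyCN.
by rewrite -[- 'X]mulN1r exprMn -!polyC1; ring.
Qed.

Section InverseSeries.

Variables (R : nzRingType) (c : nat -> R).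

(** The newest coefficient comes first; the whole list is carried along because each coefficient of
    the inverse depends on all earlier ones. *)
Fixpoint inverse_series_list (n : nat) : seq R :=
  if n is n'.+1 then
    (- \sum_(0 <= k < n) c k.+1 * nth 0 (inverse_series_list n') k)
      :: inverse_series_list n'
  else [:: 1].

Definition inverse_series (n : nat) : R := head 0 (inverse_series_list n).

Lemma nth_inverse_series n k : (k <= n)%N ->
  nth 0 (inverse_series_list n) k = inverse_series (n - k).
Proof.
by elim: n k => [|n IHn] [|k] //= le_kn; rewrite IHn.
Qed.

Lemma inverse_seriesS n :
  inverse_series n.+1 = - \sum_(0 <= k < n.+1) c k.+1 * inverse_series (n - k).
Proof.
rewrite {1}/inverse_series [inverse_series_list _]/=; congr (- _).
rewrite !big_nat; apply: eq_bigr => k /andP[_ lt_kn].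
by rewrite nth_inverse_series.
Qed.

Lemma inverse_series_unique (u : nat -> R) m : c 0%N = 1 ->
  (forall r, (0 < r <= m)%N -> \sum_(0 <= k < r.+1) c k * u (r - k)%N = 0) ->
  forall r, (r <= m)%N -> u r = inverse_series r * u 0%N.
Proof.
move=> c0 rec r; elim/ltn_ind: r => [[|r]] IHr le_rm; first by rewrite mul1r.
have := rec r.+1 le_rm; rewrite big_nat_recl //= c0 mul1r subn0.
move/eqP; rewrite addr_eq0 => /eqP->; rewrite inverse_seriesS mulNr mulr_suml.
congr (- _); rewrite !big_nat; apply: eq_bigr => k /andP[_ lt_kr].
rewrite subSS (IHr (r - k)%N) ?mulrA ?ltnS ?leq_subr //.
by apply: leq_trans (ltnW le_rm); apply: leq_subr.
Qed.

End InverseSeries.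

Lemma last_le_path K c : path geq K c -> (last K c <= K)%N.
Proof.
elim: c K => //= k c IHc K /andP[/= le_kK /IHc le_last].
exact: leq_trans le_last le_kK.
Qed.

Lemma last_small W K c : size c = W -> path geq K c -> (sumn c < W)%N ->
  last K c = 0%N.
Proof.
move=> size_c path_c; have : (size c * last K c <= sumn c)%N.
  elim: c K path_c {size_c} => //= k c IHc K /andP[_ path_c].
  by rewrite mulSn leq_add ?IHc ?last_le_path.
rewrite size_c; case: (last K c) => // p; rewrite mulnS => le_W lt_W; lia.
Qed.

(** * Pieri rules for the normalized Hall-Littlewood polynomials *)

Section HallLittlewoodPieri.

Variables (F : fieldType) (q : F) (N : nat) (x : 'I_N -> F).
Hypothesis qfact_neq0 : forall n, qfact q n != 0.

(** Each entry of [b] meets only the entries of [a] and [c] in its own column and the next, so the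
    tail of [b] can be summed first. This forces the tails of [a] and [c] to agree, and the head is
    then [gauss_inversion]. If the head of [b] is shorter than the next column of [c], the
    $q$-binomial of [vstrip] vanishes. *)
Lemma hstrip_vstrip_inversion W K a c : size a = W -> size c = W ->
  sorted geq a -> path geq K c ->
  \sum_(b <- cols W K) hstrip q a b * vstrip q (-1) b c = (a == c)%:R.
Proof.
elim: W K a c => [|W IHW] K [|h a] [|k c] //=; first by rewrite big_seq1 mulr1.
move=> [size_a] [size_c] path_a /andP[/= le_kK path_c].
rewrite big_colsS /= eqseq_cons.
transitivity (\sum_(0 <= b < K.+1) (-1) ^+ (b + k) *
    ((if (h <= b)%N then q ^+ 'C(b - h, 2) * gauss q (b - head 0%N a) (h - head 0%N a)
      else 0) *
     (if (b <= k)%N then gauss q (k - head 0%N c) (k - b) else 0)) * (a == c)%:R).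
  rewrite !big_nat; apply: eq_bigr => b /andP[_]; rewrite ltnS => le_bK.
  have [le_bk | _] := leqP b k; last first.
    by rewrite !mulr0 mul0r; apply: big1 => b' _; rewrite mul0r mulr0.
  have [le_cb | lt_bc] := leqP (head 0%N c) b; last first.
    have le_ck : (head 0%N c <= k)%N by case: (c) path_c => //= c1 c' /andP[].
    rewrite [gauss q (k - head 0%N c) _]gauss_small ?mulr0 ?mul0r; last by lia.
    by apply: big1 => b' _; rewrite !(mulr0, mul0r).
  rewrite -(IHW b a c) //; last 2 first.
  - exact: path_sorted path_a.
  - by case: (c) path_c le_cb => //= c1 c' /andP[_ ->] ->.
  rewrite !mulr_sumr; apply: eq_bigr => b' _.
  have -> : (-1) ^+ (b + k) = (-1) ^+ (k - b) :> F.
    have -> : (b + k = b.*2 + (k - b))%N by lia.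
    by rewrite -signr_odd oddD odd_double signr_odd.
  by case: ifP => _; ring.
rewrite -mulr_suml; have [eq_ac | _] := eqVneq a c; last by rewrite mulr0 andbF.
rewrite mulr1 andbT -eq_ac gauss_inversion //.
  by case: (a) path_a => //= ? ? /andP[].
by case: (a) eq_ac path_c => //= a1 a' <- /andP[].
Qed.

(** [M] and [C] are the preceding columns of the smaller and the larger diagram; the extra factor is
    what one column passes on to the next. For [M = C] it is 1, so [estrip] and [vstrip] differ
    exactly by the normalizations. *)
Lemma estrip_vlist (t : F) M C b c : (M <= C)%N -> path geq M b -> path geq C c ->
  size b = size c -> last M b = 0%N ->
  estrip q t M b c * vlist q C c =
  vlist q M b * gauss q (C - head 0%N c) (C - M) * qfact q (C - M) * vstrip q t b c.
Proof.
elim: b M C c => [|h b IHb] M C [|k c] //=.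
  by move=> _ _ _ _ ->; rewrite subn0 gaussnn qfact0; ring.
move=> le_MC /andP[/= le_hM path_b] /andP[/= le_kC path_c] [size_bc] last_b.
have [le_hk | _] := leqP h k; last by rewrite !(mul0r, mulr0).
have [le_kM | lt_Mk] := leqP k M; last first.
  rewrite [gauss q (M - h) _]gauss_small ?[gauss q (C - k) _]gauss_small; last 2 first.
  - by lia.
  - by lia.
  by rewrite !(mulr0, mul0r).
have IH := IHb h k c le_hk path_b path_c size_bc last_b.
have key : gauss q (M - h) (k - h) * qfact q (k - h) * qfact q (C - k) =
    qfact q (M - h) * gauss q (C - k) (C - M) * qfact q (C - M).
  apply: (mulIf (qfact_neq0 (M - k))).
  have E1 := gauss_qfact q (k - h) (M - k).
  have E2 := gauss_qfact q (C - M) (M - k).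
  have e1 : (k - h + (M - k) = M - h)%N by lia.
  have e2 : (C - M + (M - k) = C - k)%N by lia.
  by rewrite e1 in E1; rewrite e2 in E2; rewrite -E1 -[qfact q (C - k)]E2; ring.
transitivity (t ^+ (k - h) * gauss q (M - h) (k - h) * qfact q (C - k) *
    (estrip q t h b c * vlist q k c)); first by ring.
rewrite IH; transitivity (t ^+ (k - h) * vlist q h b *
   gauss q (k - head 0%N c) (k - h) * vstrip q t b c *
   (gauss q (M - h) (k - h) * qfact q (k - h) * qfact q (C - k))); first by ring.
by rewrite key; ring.
Qed.

Hypothesis x_inj : injective x.
Hypothesis two_neq0 : 2%:R != 0 :> F.

Definition theta (a b : F) : F := (a - q * b) / (a - b).

Definition hl_kernel (w : 'S_N) : F :=
  \prod_(i < N) \prod_(j < N | (i < j)%N) theta (x (w i)) (x (w j)).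

(** An adjacent transposition permutes all pairs [i < j] except the transposed one, so a single
    factor [theta] changes. *)
Lemma hl_kernel_swap (w : 'S_N) (i j : 'I_N) : j = i.+1 :> nat ->
  (x (w j) - q * x (w i)) * hl_kernel w =
  - ((x (w i) - q * x (w j)) * hl_kernel (tperm i j * w)%g).
Proof.
move=> ji; have neq_ij : i != j by rewrite -val_eqE /= ji ltn_eqF.
pose rest (p : 'I_N * 'I_N) := (p.1 < p.2)%N && (p != (i, j)).
have kernelE z : hl_kernel z = theta (x (z i)) (x (z j)) *
    \prod_(p | rest p) theta (x (z p.1)) (x (z p.2)).
  rewrite /hl_kernel pair_big_dep (bigD1 (i, j)) //=.
  by rewrite ji.
have swap_rest : \prod_(p | rest p)
      theta (x ((tperm i j * w)%g p.1)) (x ((tperm i j * w)%g p.2)) =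
    \prod_(p | rest p) theta (x (w p.1)) (x (w p.2)).
  pose s (p : 'I_N * 'I_N) := (tperm i j p.1, tperm i j p.2).
  have s_inj : injective s.
    by move=> [a b] [a' b'] [/perm_inj-> /perm_inj->].
  rewrite [RHS](reindex_inj s_inj); apply: eq_big => [[a b] | p _]; last first.
    by rewrite !permM.
  rewrite /rest /s /= !xpair_eqE -!val_eqE /=.
  have tperm_val c : tperm i j c =
      (if c == i :> nat then i.+1 else if c == i.+1 :> nat then i else c) :> nat.
    case: tpermP => [->|->|/eqP]; rewrite ?eqxx -?ji //.
      by rewrite eqxx ji gtn_eqF.
    by rewrite -val_eqE => /negPf-> /eqP; rewrite -val_eqE => /negPf->.
  rewrite !tperm_val ji.
  do 2!case: eqP => [?|?]; do 2?case: eqP => [?|?]; lia.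
rewrite !kernelE swap_rest !permM tpermL tpermR mulrA [in RHS]mulrA -[RHS]mulNr.
congr (_ * _); rewrite /theta.
have nz : x (w i) - x (w j) != 0.
  by rewrite subr_eq0 (inj_eq x_inj) (inj_eq perm_inj).
have nz' : x (w j) - x (w i) != 0 by rewrite -opprB oppr_eq0.
by field; rewrite nz nz'.
Qed.

Definition hlQ (c : seq nat) : F := symmetrize hl_kernel (mono x c).

Definition hlP (c : seq nat) : F := hlQ c / vlist q N c.

(** The coefficients are $(-1)^re_r$; with the sign built in, the inverse series has the
    coefficients $h_r$. *)
Definition elem_poly : {poly F} := \prod_(i < N) (1 - (x i)%:P * 'X).

Lemma vlist_neq0 M c : vlist q M c != 0.
Proof. by elim: c M => //= k c IHc M; rewrite mulf_neq0. Qed.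

(** [symmetrize_elem] over [{poly F}] with $t=-X$, compared in the coefficient of $X^r$. *)
Lemma elem_hlQ r b : path geq N b -> last N b = 0%N ->
  elem_poly`_r * hlQ b =
  \sum_(c <- cols (size b) N | sumn c == (sumn b + r)%N)
    estrip q (-1) N b c * hlQ c.
Proof.
move=> path_b last_b.
pose xp i : {poly F} := (x i)%:P; pose Dp w : {poly F} := (hl_kernel w)%:P.
have reg (p : {poly F}) : p + p = 0 -> p = 0.
  move=> pp; apply/polyP => i; have := congr1 (fun p : {poly F} => p`_i) pp.
  rewrite coefD coef0 -mulr2n -mulr_natl => /eqP.
  by rewrite mulf_eq0 (negPf two_neq0) => /eqP.
have Dp_swap (w : 'S_N) (i j : 'I_N) : j = i.+1 :> nat ->
    (xp (w j) - q%:P * xp (w i)) * Dp w =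
    - ((xp (w i) - q%:P * xp (w j)) * Dp (tperm i j * w)%g).
  by move=> ji; rewrite -!polyCM -!polyCB -!polyCM -polyCN hl_kernel_swap.
have xatC w k : xat xp w k = (xat x w k)%:P by rewrite /xat; case: insubP.
have symC c : symmetrize Dp (mono xp c) = (hlQ c)%:P.
  rewrite /hlQ /symmetrize rmorph_sum; apply: eq_bigr => w _; rewrite rmorphM.
  congr (_ * _); rewrite rmorph_prod; apply: eq_bigr => k _.
  by rewrite rmorph_prod; apply: eq_bigr => l _; rewrite xatC.
have pieri := @symmetrize_elem _ q%:P (- 'X) N xp Dp reg Dp_swap b path_b last_b.
have elemE : elem_poly = \prod_(i < N) (1 + (- 'X) * xp i).
  by apply: eq_bigr => i _; rewrite mulNr mulrC.
rewrite -coefMC; have -> : elem_poly * (hlQ b)%:P = \sum_(c <- cols (size b) N)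
    (estrip q (-1) N b c * hlQ c)%:P * 'X^(sumn c - sumn b).
  rewrite elemE -symC pieri.
  apply: eq_big_seq => c; rewrite mem_cols => /andP[/eqP size_c _].
  by rewrite symC estrip_polyC // polyCM mulrAC.
rewrite coef_sum [RHS]big_mkcond; apply: eq_big_seq => c.
rewrite mem_cols => /andP[/eqP size_c _]; rewrite coefCM coefXn.
have [-> | nz] := eqVneq (estrip q (-1) N b c) 0; first by rewrite !mul0r if_same.
have le_bc := estrip_sumn (esym size_c) nz.
rewrite (_ : (r == _) = (sumn c == (sumn b + r)%N)); last by lia.
by case: eqP; rewrite ?mulr1 ?mulr0.
Qed.

Lemma elem_hlP r b : path geq N b -> last N b = 0%N ->
  elem_poly`_r * hlP b =
  \sum_(c <- cols (size b) N | sumn c == (sumn b + r)%N)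
    vstrip q (-1) b c * hlP c.
Proof.
move=> path_b last_b; rewrite /hlP mulrA elem_hlQ // mulr_suml.
rewrite big_seq_cond [RHS]big_seq_cond; apply: eq_bigr => c.
rewrite mem_cols => /andP[/andP[/eqP size_c path_c] _].
have := estrip_vlist (-1) (leqnn N) path_b path_c (esym size_c) last_b.
rewrite subnn gauss0 qfact0 !mulr1 => E.
have nzb := vlist_neq0 N b; have nzc := vlist_neq0 N c.
apply: (mulIf nzb); apply: (mulIf nzc); rewrite divfK // mulrAC E.
by field; rewrite nzc.
Qed.

Definition hsymm (r : nat) : F := inverse_series (fun k => elem_poly`_k) r.

Lemma elem_poly0 : elem_poly`_0 = 1.
Proof.
rewrite -horner_coef0 horner_prod big1 // => i _.
by rewrite !hornerE subr0.
Qed.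

(** The right-hand sides [u s] satisfy the recursion that determines the $h_s$ from the $e_k$:
    applying the rule for $e_k$ to them produces the sums of [hstrip_vstrip_inversion]. The bound by
    [W] makes the last column empty in every diagram to which that rule is applied. *)
Lemma hlP_pieri W r a : path geq N a -> size a = W -> (sumn a + r < W)%N ->
  hsymm r * hlP a =
  \sum_(c <- cols W N | sumn c == (sumn a + r)%N) hstrip q a c * hlP c.
Proof.
move=> path_a size_a lt_W.
pose u r := \sum_(c <- cols W N | sumn c == (sumn a + r)%N) hstrip q a c * hlP c.
have u0 : u 0%N = hlP a.
  rewrite /u addn0 big_mkcond (bigD1_seq a) ?cols_uniq ?mem_cols ?size_a ?eqxx //=.
  rewrite hstripnn mul1r big1_seq ?addr0 // => c /andP[neq_ca].
  rewrite mem_cols => /andP[/eqP size_c _]; case: eqP => // sum_c.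
  by rewrite hstrip_eq_sumn ?size_c ?sum_c // eq_sym (negPf neq_ca) mul0r.
rewrite -u0 -(@inverse_series_unique _ _ u r) ?elem_poly0 // => {u0} s.
case/andP => s_gt0 le_sr.
transitivity (\sum_(c <- cols W N | sumn c == (sumn a + s)%N)
   (\sum_(b <- cols W N) hstrip q a b * vstrip q (-1) b c) * hlP c); last first.
  rewrite big_seq_cond; apply: big1 => c; rewrite mem_cols.
  move=> /andP[/andP[/eqP size_c path_c] /eqP sum_c].
  rewrite hstrip_vstrip_inversion //; last exact: path_sorted path_a.
  case: eqP => [ac|_]; last by rewrite mul0r.
  by move: s_gt0; rewrite -(ltn_add2l (sumn a)) -sum_c ac addn0 ltnn.
transitivity (\sum_(0 <= k < s.+1) \sum_(b <- cols W N)
   \sum_(c <- cols W N | sumn c == (sumn a + s)%N)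
   (sumn b + k == sumn a + s)%N%:R * (hstrip q a b * vstrip q (-1) b c * hlP c)).
  rewrite !big_nat; apply: eq_bigr => k /andP[_]; rewrite ltnS => le_ks.
  rewrite mulr_sumr big_mkcond; apply: eq_big_seq => b.
  rewrite mem_cols => /andP[/eqP size_b path_b].
  rewrite (_ : (sumn b == _) = (sumn b + k == sumn a + s)%N); last by lia.
  case: eqP => [sum_b | _]; last first.
    by rewrite big1 // => c _; rewrite mul0r.
  rewrite mulrCA elem_hlP //; last first.
    by apply: (last_small size_b path_b); lia.
  rewrite size_b sum_b mulr_sumr; apply: eq_bigr => c _.
  by rewrite mul1r mulrA.
rewrite exchange_big /=; under eq_bigr do rewrite exchange_big /=.
rewrite exchange_big /= big_seq_cond [RHS]big_seq_cond; apply: eq_bigr => c.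
rewrite mem_cols => /andP[/andP[/eqP size_c _] /eqP sum_c].
rewrite mulr_suml; apply: eq_big_seq => b; rewrite mem_cols => /andP[/eqP size_b _].
have [-> | nz] := eqVneq (hstrip q a b * vstrip q (-1) b c) 0.
  by rewrite mul0r; apply: big1 => k _; rewrite mulr0.
have le_ab : (sumn a <= sumn b)%N.
  by apply: (@hstrip_sumn _ q); rewrite ?size_a ?size_b //;
    apply: contra_neq nz => ->; rewrite mul0r.
have le_bc : (sumn b <= sumn c)%N.
  by apply: (@vstrip_sumn _ q (-1)); rewrite ?size_c ?size_b //;
    apply: contra_neq nz => ->; rewrite mulr0.
rewrite (bigD1_seq (sumn a + s - sumn b)%N) ?iota_uniq //=; last first.
  by rewrite mem_index_iota; lia.
rewrite (_ : (_ + _ == _)%N = true) ?mul1r; last by lia.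
rewrite big1 ?addr0 // => k /eqP neq_k.
by rewrite (_ : (_ + _ == _)%N = false) ?mul0r //; apply/eqP; lia.
Qed.

End HallLittlewoodPieri.

(** * The sum of the kernel over all permutations, and $P_\emptyset=1$ *)

Lemma sum_lift_perm (V : nmodType) n (G : 'S_n.+1 -> V) :
  \sum_w G w = \sum_k \sum_s G (lift_perm ord0 k s).
Proof.
rewrite pair_big (reindex (fun p : 'I_n.+1 * 'S_n => lift_perm ord0 p.1 p.2)) //.
apply: onW_bij; apply: inj_card_bij; last by rewrite card_prod card_ord !card_Sn.
move=> [k s] [k' s'] /= eq_l.
have eq_k : k = k' by rewrite -(lift_perm_id ord0 k s) eq_l lift_perm_id.
rewrite {k}eq_k in eq_l *; congr (_, _); apply/permP => i.
by apply: (@lift_inj _ k'); rewrite -!(lift_perm_lift ord0) eq_l.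
Qed.

Lemma size_prod_XsubC_ord (R : nzRingType) m (f : 'I_m -> R) :
  size (\prod_(i < m) ('X - (f i)%:P)) = m.+1.
Proof.
by rewrite size_prod_XsubC -sum1_size big_const_ord iter_addn_0 mul1n.
Qed.

Section HallLittlewoodUnit.

Variables (F : fieldType) (q : F).
Hypothesis q_neq1 : 1 - q != 0.

(* Lagrange interpolation of the polynomial                                    *)
(* (\prod_j (X - q x_j) - q^n \prod_j (X - x_j)) / X at the points x_k,        *)
(* compared in leading coefficients.                                           *)
Lemma sum_theta n (x : 'I_n.+1 -> F) : injective x -> (forall k, x k != 0) ->
  \sum_k \prod_(i < n) theta q (x k) (x (lift k i)) = qint q n.+1.
Proof.
move=> x_inj x_neq0; apply: (mulfI q_neq1); rewrite qint_geom.
pose pq : {poly F} := \prod_j ('X - (q * x j)%:P).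
pose px : {poly F} := \prod_j ('X - (x j)%:P).
pose p := pq - q ^+ n.+1 *: px.
have size_pq : size pq = n.+2 by apply: size_prod_XsubC_ord.
have size_px : size px = n.+2 by apply: size_prod_XsubC_ord.
have p_root0 : root p 0.
  rewrite /root /p !hornerE !horner_prod.
  under eq_bigr do rewrite !hornerE -mulrN.
  under [X in _ - _ * X]eq_bigr do rewrite !hornerE.
  by rewrite big_split prodr_const card_ord subrr.
have /factor_theorem[r] := p_root0; rewrite subr0 => pE.
have size_p : (size p <= n.+2)%N.
  rewrite (leq_trans (size_polyD _ _)) // geq_max size_pq leqnn size_polyN.
  by rewrite (leq_trans (size_scale_leq _ _)) ?size_px.
have size_r : (size r <= n.+1)%N.
  have [->|r0] := eqVneq r 0; first by rewrite size_poly0.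
  by rewrite -ltnS -(size_mulX r0) -pE.
have coef_r : r`_n = 1 - q ^+ n.+1.
  have <- : p`_n.+1 = r`_n by rewrite pE coefMX.
  rewrite coefB coefZ -[n.+1]/(n.+2.-1) -{1}size_pq -size_px.
  have /monicP : pq \is monic by apply: monic_prod_XsubC.
  have /monicP : px \is monic by apply: monic_prod_XsubC.
  by rewrite !lead_coefE => -> ->; rewrite size_px mulr1.
have r_x k : r.[x k] =
    (1 - q) * \prod_(i < n) (x k - q * x (lift k i)).
  apply: (mulIf (x_neq0 k)); have := congr1 (fun p => p.[x k]) pE.
  rewrite [RHS]hornerMX => <-; rewrite /p !hornerE !horner_prod.
  have -> : \prod_i ('X - (x i)%:P).[x k] = 0.
    by rewrite (bigD1 k) //= hornerXsubC subrr mul0r.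
  have -> : \prod_i ('X - (q * x i)%:P).[x k] =
      (x k - q * x k) * \prod_(i < n) (x k - q * x (lift k i)).
    rewrite (bigD1_ord k) //= hornerXsubC; congr (_ * _).
    by apply: eq_bigr => i _; rewrite hornerXsubC.
  by ring.
pose l (k : 'I_n.+1) : {poly F} := \prod_(i < n) ('X - (x (lift k i))%:P).
pose d (k : 'I_n.+1) := \prod_(i < n) (x k - x (lift k i)).
have d_neq0 k : d k != 0.
  apply/prodf_neq0 => i _; rewrite subr_eq0 (inj_eq x_inj).
  exact: neq_lift.
pose s := \sum_k (r.[x k] / d k) *: l k.
have size_l k : size (l k) = n.+1 by apply: size_prod_XsubC_ord.
have rs : r - s = 0.
  apply: (@roots_geq_poly_eq0 _ _ [seq x k | k <- enum 'I_n.+1]).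
  - apply/allP => _ /mapP[m _ ->]; rewrite /root hornerD hornerN horner_sum.
    rewrite (bigD1 m) //= hornerZ (_ : (l m).[x m] = d m); last first.
      by rewrite horner_prod; apply: eq_bigr => i _; rewrite !hornerE.
    rewrite divfK // big1 ?addr0 ?subrr // => k neq_km.
    rewrite hornerZ; have /unlift_some[i mi _] := neq_km.
    rewrite (_ : (l k).[x m] = 0) ?mulr0 //.
    by rewrite horner_prod (bigD1 i) //= !hornerE mi ?subrr ?mul0r.
  - by rewrite map_inj_uniq ?enum_uniq.
  - rewrite size_map size_enum_ord (leq_trans (size_polyD _ _)) // geq_max size_r.
    rewrite size_polyN; apply: (leq_trans (size_sum _ _ _)).
    apply/bigmax_leqP => k _.
    by rewrite (leq_trans (size_scale_leq _ _)) ?size_l.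
move/eqP: rs; rewrite subr_eq0 => /eqP rs.
rewrite -coef_r rs coef_sum mulr_sumr; apply: eq_bigr => k _.
rewrite coefZ r_x -mulrA -[in RHS]mulrA; congr (_ * _).
have -> : (l k)`_n = 1.
  have /monicP : l k \is monic by apply: monic_prod_XsubC.
  by rewrite lead_coefE size_l.
by rewrite mulr1 /d -prodf_div.
Qed.

(** Permutations are grouped by the variable [x k] put in first position. The remaining variables
    contribute [qfact q N] whatever [k] is, and the factors involving [x k] add up by
    [sum_theta]. *)
Lemma sum_hl_kernel N (x : 'I_N -> F) : injective x -> (forall k, x k != 0) ->
  \sum_w hl_kernel q x w = qfact q N.
Proof.
elim: N x => [|N IHN] x x_inj x_neq0.
  rewrite qfact0 (bigD1 1%g) //= big1 ?addr0; last first.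
    by move=> w /eqP[]; apply/permP => - [].
  by rewrite /hl_kernel big_ord0.
rewrite sum_lift_perm qfactS -(sum_theta x_inj x_neq0) mulr_sumr.
apply: eq_bigr => k _.
rewrite -(IHN (fun i => x (lift k i))); last 2 first.
- by move=> i j /x_inj/lift_inj.
- by move=> i; apply: x_neq0.
rewrite mulr_suml; apply: eq_bigr => s _.
rewrite /hl_kernel big_ord_recl mulrC; congr (_ * _).
  apply: eq_bigr => i _; rewrite big_mkcond big_ord_recl /= mul1r -big_mkcond.
  by apply: eq_bigr => j _; rewrite !lift_perm_lift.
rewrite big_mkcond big_ord_recl /= mul1r lift_perm_id.
rewrite [RHS](reindex_inj (@perm_inj _ s)).
by apply: eq_bigr => i _; rewrite lift_perm_lift.
Qed.

Lemma hlP_nseq0 N (x : 'I_N -> F) k : injective x -> (forall i, x i != 0) ->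
  qfact q N != 0 -> hlP q x (nseq k 0%N) = 1.
Proof.
move=> x_inj x_neq0 qN_neq0; rewrite /hlP.
have -> : vlist q N (nseq k 0%N) = qfact q N.
  have v0 j : vlist q 0 (nseq j 0%N) = 1.
    by elim: j => [|j IHj] /=; rewrite ?IHj ?subn0 qfact0 ?mulr1.
  by case: k => //= k; rewrite v0 subn0 mulr1.
have -> : hlQ q x (nseq k 0%N) = qfact q N.
  rewrite -(sum_hl_kernel x_inj x_neq0); apply: eq_bigr => w _.
  rewrite /mono big1_seq ?mul1r // => j /= /nseqP[-> _].
  by rewrite big_geq.
by rewrite divff.
Qed.

End HallLittlewoodUnit.

(** * Hall-Littlewood polynomials in concrete variables *)

Lemma intpart_sorted (p : intpart) : sorted geq p.
Proof. by have /andP[] := partsP p. Qed.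

Lemma part_eq0 (p : intpart) i : (part p i == 0%N) = (size p <= i)%N.
Proof.
have [le_pi | lt_ip] := leqP (size p) i; first by rewrite /part nth_default.
have /andP[_ p0] := partsP p.
by apply: contraNF p0 => /eqP <-; apply: mem_nth.
Qed.

Lemma intpart_eq (p r : intpart) : (forall i, part p i = part r i) -> p = r.
Proof.
move=> eq_part; apply: val_inj; apply: (@eq_from_nth _ 0%N) => [|i _]; last first.
  exact: eq_part.
by apply/eqP; rewrite eqn_leq -!part_eq0 eq_part part_eq0 leqnn -eq_part part_eq0 /=.
Qed.

Lemma part_le (p : intpart) i j : (i <= j)%N -> (part p j <= part p i)%N.
Proof.
have geq_trans : transitive geq by move=> a b c /= le1 le2; apply: leq_trans le2 le1.
move=> le_ij; have [le_pj | lt_jp] := leqP (size p) j.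
  by rewrite [part p j]nth_default.
have := sorted_leq_nth geq_trans leqnn 0%N (intpart_sorted p).
by apply; rewrite // inE (leq_ltn_trans le_ij).
Qed.

Lemma count_gt_sorted s i j : sorted geq s ->
  (i < count (fun x => j < x)%N s)%N = (j < nth 0%N s i)%N.
Proof.
elim: s i => [|x s IHs] i; first by rewrite nth_nil.
rewrite [sorted _ _]/= => path_s; have sorted_s := path_sorted path_s.
have s_le_x : all (geq x) s.
  by apply: order_path_min path_s => a1 a2 a3 /= ? ?; lia.
rewrite /=; have [lt_jx | le_xj] := ltnP j x.
  by case: i => [|i] //=; rewrite add1n ltnS IHs.
rewrite add0n (eq_in_count (a2 := pred0)) ?count_pred0; last first.
  by move=> y /(allP s_le_x) /= le_yx; rewrite ltnNge (leq_trans le_yx).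
rewrite ltn0; symmetry; apply/negbTE; rewrite -leqNgt; case: i => [|i] //=.
have [le_si | lt_is] := leqP (size s) i; first by rewrite nth_default.
by apply: leq_trans le_xj; apply: (allP s_le_x); apply: mem_nth.
Qed.

Lemma part_conj_count (p : intpart) j :
  part (conj_partition p) j = count (fun x => j < x)%N p.
Proof.
rewrite /part /= /conj_parts.
have [lt_j | le_j] := ltnP j (head 0%N p); first by rewrite nth_mkseq.
rewrite nth_default ?size_mkseq //; symmetry; apply/eqP.
rewrite -leqn0 leqNgt count_gt_sorted ?intpart_sorted //.
by rewrite -leqNgt nth0.
Qed.

(** Both inequalities say that one and the same box lies in the diagram; the properties of
    conjugation used here follow from this. *)
Lemma lt_part_conj (p : intpart) i j :
  (i < part (conj_partition p) j)%N = (j < part p i)%N.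
Proof. by rewrite part_conj_count count_gt_sorted ?intpart_sorted. Qed.

Lemma conj_partitionK : involutive conj_partition.
Proof.
move=> p; apply: intpart_eq => i; apply/eqP; rewrite eqn_leq; apply/andP; split.
  by rewrite leqNgt lt_part_conj -leqNgt leqNgt lt_part_conj -leqNgt.
by rewrite leqNgt -lt_part_conj -leqNgt leqNgt -lt_part_conj -leqNgt.
Qed.

Lemma part_conj0 (p : intpart) : part (conj_partition p) 0 = size p.
Proof.
have /andP[_ p0] := partsP p.
rewrite part_conj_count; apply/eqP; rewrite -all_count; apply/allP => x x_p.
by rewrite lt0n; apply: contraNneq p0 => <-.
Qed.

Lemma weightE (p : intpart) W : (size p <= W)%N ->
  weight p = (\sum_(i < W) part p i)%N.
Proof.
move=> le_pW; rewrite /weight sumnE (big_nth 0%N) -(big_mkord xpredT (part p)).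
rewrite [RHS](@big_cat_nat _ _ _ (size p)) //= [X in (_ + X)%N]big1_seq ?addn0 //.
by move=> i; rewrite mem_index_iota => /andP[_ /andP[le_pi _]];
  apply/eqP; rewrite part_eq0.
Qed.

Lemma sum_ord_lt k W : (k <= W)%N -> (\sum_(j < W) (j < k)%N)%N = k.
Proof.
move=> le_kW; rewrite -(big_mkord xpredT (fun j => nat_of_bool (j < k)%N)).
rewrite (@big_cat_nat _ _ _ k) //= !big_nat.
under eq_bigr => j /andP[_ ->] do [].
rewrite [X in (_ + X)%N]big1 => [|j /andP[le_kj _]]; last by rewrite ltnNge le_kj.
by rewrite -big_nat sum_nat_const_nat subn0 muln1 addn0.
Qed.

Lemma part_le_weight (p : intpart) i : (part p i <= weight p)%N.
Proof. exact: nth_le_sumn. Qed.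

Lemma size_le_weight (p : intpart) : (size p <= weight p)%N.
Proof. by apply: size_le_sumn; have /andP[] := partsP p. Qed.

Lemma weight_conj (p : intpart) : weight (conj_partition p) = weight p.
Proof.
have [W le_sW le_pW] : exists2 W, (size p <= W)%N & (part p 0 <= W)%N.
  by exists (weight p); rewrite ?size_le_weight ?part_le_weight.
have le_cW : (size (conj_partition p) <= W)%N by rewrite size_mkseq -nth0.
rewrite (weightE le_cW) (weightE le_sW).
transitivity (\sum_(j < W) \sum_(i < W) (j < part p i)%N)%N.
  apply: eq_bigr => j _; rewrite -[LHS](@sum_ord_lt _ W).
    by apply: eq_bigr => i _; rewrite lt_part_conj.
  by apply: leq_trans (part_le _ (leq0n j)) _; rewrite part_conj0.
rewrite exchange_big; apply: eq_bigr => i _.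
by rewrite -[RHS](@sum_ord_lt _ W) // (leq_trans (part_le _ (leq0n i))).
Qed.

(** The width [m.+1] exceeds every weight up to [m], as [hlP_pieri] requires. *)
Definition pad (m : nat) (p : intpart) : seq nat := mkseq (part p) m.+1.

Lemma size_pad m p : size (pad m p) = m.+1.
Proof. exact: size_mkseq. Qed.

Lemma nth_pad m p i : (weight p <= m)%N -> nth 0%N (pad m p) i = part p i.
Proof.
move=> le_pm; have [lt_im | le_mi] := ltnP i m.+1; first by rewrite nth_mkseq.
rewrite nth_default ?size_pad //; symmetry; apply/eqP; rewrite part_eq0.
by apply: leq_trans (size_le_weight p) (leq_trans le_pm (ltnW le_mi)).
Qed.

Lemma sumn_pad m p : (weight p <= m)%N -> sumn (pad m p) = weight p.
Proof.
move=> le_pm; rewrite (@weightE p m.+1); last first.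
  by rewrite (leq_trans (size_le_weight p)) // ltnW.
by rewrite sumnE big_map -(big_mkord xpredT (part p)) /index_iota subn0.
Qed.

Lemma path_pad N m (p : intpart) : (part p 0 <= N)%N -> path geq N (pad m p).
Proof.
move=> le_pN; apply/(pathP 0%N) => i; rewrite size_pad => lt_im.
rewrite nth_mkseq //; case: i lt_im => [|i] lt_im //=.
by rewrite nth_mkseq ?part_le // ltnW.
Qed.

Lemma filter_nonzero_sorted c i : sorted geq c ->
  nth 0%N (filter (predC1 0%N) c) i = nth 0%N c i.
Proof.
elim: c i => //= x c IHc i path_c; have sorted_c := path_sorted path_c.
case: eqP => [x0 | _] /=; last by case: i => //= i; apply: IHc.
have c0 j : nth 0%N c j = 0%N.
  have c_le_x : all (geq x) c.
    by apply: order_path_min path_c => a1 a2 a3 /= ? ?; lia.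
  have [le_cj | lt_jc] := leqP (size c) j; first by rewrite nth_default.
  by have /= := allP c_le_x _ (mem_nth 0%N lt_jc); rewrite x0 leqn0 => /eqP.
by rewrite IHc // c0 x0; case: i => //= i; rewrite c0.
Qed.

Lemma big_cols_bounded (V : nmodType) m N s (f : seq nat -> V) : (s <= m)%N ->
  \sum_(c <- cols m.+1 N | sumn c == s) f c =
  \sum_(k : bounded_partition m | (weight k == s) && (part k 0 <= N)%N) f (pad m k).
Proof.
move=> le_sm.
pose P := [pred k : bounded_partition m | (weight k == s) && (part k 0 <= N)%N].
transitivity (\sum_(c <- [seq pad m k | k : bounded_partition m <- enum P]) f c).
  rewrite -big_filter; apply: perm_big; apply: uniq_perm; first by rewrite filter_uniq ?cols_uniq.
    rewrite map_inj_uniq ?enum_uniq //.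
    move=> k k' eq_kk'; apply/val_inj/intpart_eq => i.
    by rewrite -(@nth_pad m) ?bpartP // eq_kk' nth_pad ?bpartP.
  move=> c; rewrite mem_filter mem_cols; apply/idP/mapP.
    move=> /andP[/eqP sum_c /andP[/eqP size_c path_c]].
    have sorted_c := path_sorted path_c.
    have part_c : is_partition (filter (predC1 0%N) c).
      rewrite /is_partition mem_filter /= andbT sorted_filter //.
      by move=> a1 a2 a3 /= ? ?; lia.
    pose p := IntPart part_c.
    have partE i : part p i = nth 0%N c i by apply: filter_nonzero_sorted.
    have padE : pad m p = c.
      apply: (@eq_from_nth _ 0%N); first by rewrite size_pad.
      by move=> i; rewrite size_pad => lt_im; rewrite nth_mkseq.
    have weight_p : weight p = s.
      rewrite -sum_c /weight /=; elim: (c) => //= x c' <-.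
      by case: eqP => [->|].
    have le_pm : (weight p <= m)%N by rewrite weight_p.
    exists (BoundedPartition le_pm) => //.
    rewrite mem_enum inE /= weight_p eqxx partE.
    by case: (c) path_c size_c => //= x c' /andP[].
  case=> k; rewrite mem_enum inE => /andP[/eqP weight_k le_kN] ->.
  by rewrite sumn_pad ?bpartP // weight_k eqxx size_pad eqxx path_pad.
by rewrite big_map big_enum.
Qed.

Lemma bconj_subproof m (k : bounded_partition m) : (weight (conj_partition k) <= m)%N.
Proof. by rewrite weight_conj bpartP. Qed.

Definition bconj m (k : bounded_partition m) : bounded_partition m :=
  BoundedPartition (bconj_subproof k).

Lemma bconjK m : involutive (@bconj m).
Proof. by move=> k; apply/val_inj/conj_partitionK. Qed.

HB.instance Definition _ (N : nat) :=
  GRing.RMorphism.copy (cst N) (@tofrac _ \o @mpolyC N _).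

Lemma rmorph_vlist (R S : comNzRingType) (f : {rmorphism R -> S}) (q : R) M c :
  f (vlist q M c) = vlist (f q) M c.
Proof.
by elim: c M => [|k c IHc] M /=; rewrite ?rmorphM ?IHc rmorph_qfact.
Qed.

Section ConcreteVariables.

Variable N : nat.

Lemma cst_inj : injective (cst N).
Proof. by move=> a b /eqP; rewrite /cst tofrac_eq mpolyC_eq => /eqP. Qed.

Lemma cst_eq0 a : (cst N a == 0) = (a == 0).
Proof. by rewrite -(rmorph0 (cst N)) (inj_eq cst_inj). Qed.

Lemma var_inj : injective (@var N).
Proof.
move=> i j /eqP; rewrite /var tofrac_eq => /eqP/(congr1 (mcoeff U_(i))).
rewrite !mcoeffXU eqxx; case: eqP => // _ /eqP.
by rewrite oner_eq0.
Qed.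

Lemma var_neq0 (i : 'I_N) : var i != 0.
Proof.
rewrite /var tofrac_eq0; apply/eqP => /(congr1 (mcoeff U_(i))).
by rewrite mcoeffXU eqxx mcoeff0 => /eqP; rewrite oner_eq0.
Qed.

Lemma vpolyE k : vpoly k = qfact 'X k.
Proof. by []. Qed.

Lemma qfact_X_neq0 k : qfact 'X k != 0 :> {poly int}.
Proof.
elim: k => [|k IHk]; first by rewrite qfact0 oner_eq0.
rewrite qfactS mulf_neq0 //; apply/eqP => q0; have := qint_geom ('X : {poly int}) k.+1.
rewrite q0 mulr0 => /eqP; rewrite eq_sym subr_eq0 => /eqP.
by move=> /(congr1 (fun p : {poly int} => size p)); rewrite size_polyXn size_poly1.
Qed.

Lemma qfact_cst_neq0 k : qfact (cst N 'X) k != 0.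
Proof. by rewrite -rmorph_qfact cst_eq0 qfact_X_neq0. Qed.

Lemma cst_two_neq0 : 2%:R != 0 :> ratfun N.
Proof. by rewrite -(rmorph_nat (cst N)) cst_eq0 -(rmorph_nat polyC) polyC_eq0. Qed.

Lemma cst_X_neq1 : 1 - cst N 'X != 0.
Proof.
rewrite -(rmorph1 (cst N)) -rmorphB cst_eq0 subr_eq0 eq_sym.
by apply/eqP => /(congr1 (fun p : {poly int} => size p)); rewrite size_polyX size_poly1.
Qed.

Lemma vlist_prod (R : comNzRingType) (q : R) M c :
  vlist q M c =
  \prod_(0 <= i < (size c).+1) qfact q (nth 0%N (M :: c) i - nth 0%N c i).
Proof.
elim: c M => [|k c IHc] M /=; first by rewrite big_nat1 subn0.
by rewrite IHc [RHS]big_nat_recl.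
Qed.

Lemma card_lt_part (p : intpart) i : (size p <= N)%N ->
  #|[set k : 'I_N | (i < part p k)%N]| = part (conj_partition p) i.
Proof.
move=> le_pN; rewrite -sum1dep_card big_mkcond /=.
under eq_bigr => k _ do rewrite -lt_part_conj.
rewrite -[RHS](@sum_ord_lt _ N) // (leq_trans (part_le _ (leq0n i))) //.
by rewrite part_conj0.
Qed.

Lemma multiplicityE (p : intpart) i : (size p <= N)%N ->
  multiplicity N p i =
  ((if i is i'.+1 then part (conj_partition p) i' else N) -
   part (conj_partition p) i)%N.
Proof.
move=> le_pN; rewrite -card_lt_part //.
have -> : (if i is i'.+1 then part (conj_partition p) i' else N) =
    #|[set k : 'I_N | (i <= part p k)%N]|.
  case: i => [|i]; last by rewrite card_lt_part.
  by rewrite -[LHS]card_ord; apply: eq_card => k; rewrite !inE.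
rewrite -cardsDS; last by apply/subsetP => k; rewrite !inE => /ltnW.
by apply: eq_card => k; rewrite !inE -leqNgt eqn_leq.
Qed.

Lemma vpart_vlist (p : intpart) m : (size p <= N)%N -> (weight p <= m)%N ->
  vpart N p = vlist 'X N (pad m (conj_partition p)).
Proof.
move=> le_pN le_pm; rewrite vlist_prod size_pad /vpart.
have le_p0m : ((part p 0).+1 <= m.+2)%N.
  by rewrite ltnS (leq_trans (part_le_weight _ _)) // ltnW.
have weight_c : (weight (conj_partition p) <= m)%N by rewrite weight_conj.
rewrite [RHS](@big_cat_nat _ _ _ (part p 0).+1) //= [X in _ * X]big1_seq ?mulr1.
  rewrite !big_nat; apply: eq_bigr => i _.
  rewrite vpolyE multiplicityE //; congr (qfact _ (_ - _)).
    by case: i => //= i; rewrite nth_pad.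
  by rewrite nth_pad.
case=> [|i]; rewrite mem_index_iota // => /andP[_ /andP[le_i _]].
have part0 : part (conj_partition p) i = 0%N.
  by apply/eqP; rewrite -leqn0 leqNgt lt_part_conj -leqNgt.
by rewrite /= nth_pad // part0 sub0n qfact0.
Qed.

Lemma mono_pad (p : intpart) m w : (size p <= N)%N -> (weight p <= m)%N ->
  mono (@var N) (pad m (conj_partition p)) w = \prod_(i < N) var (w i) ^+ part p i.
Proof.
move=> le_pN le_pm; rewrite /mono big_map.
transitivity (\prod_(j < m.+1) \prod_(i < N | (j < part p i)%N) var (w i)).
  rewrite -[iota _ _]/(index_iota 0 m.+1) big_mkord; apply: eq_bigr => j _.
  under [RHS]eq_bigl => i do rewrite -lt_part_conj.
  rewrite big_mkord (big_ord_widen N); last first.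
    by rewrite (leq_trans (part_le _ (leq0n j))) // part_conj0.
  by apply: eq_bigr => i _; rewrite xat_ord.
under eq_bigr do rewrite big_mkcond.
rewrite exchange_big; apply: eq_bigr => i _.
rewrite -big_mkcond -(big_ord_widen m.+1 (fun=> var (w i))).
  by rewrite prodr_const card_ord.
by rewrite (leq_trans (part_le_weight _ _)) // ltnW.
Qed.

Lemma hall_littlewoodE (p : intpart) m : (size p <= N)%N -> (weight p <= m)%N ->
  hall_littlewood N p = hlP (cst N 'X) (@var N) (pad m (conj_partition p)).
Proof.
move=> le_pN le_pm; rewrite /hall_littlewood /hlP mulrC; congr (_ / _).
  by apply: eq_bigr => w _; rewrite mono_pad.
by rewrite (vpart_vlist le_pN le_pm) rmorph_vlist.
Qed.

End ConcreteVariables.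

(* The coefficient of P_p in the product of the h_r, r in alpha, where k is    *)
(* the conjugate of p; the head of alpha is the outermost layer.               *)
Fixpoint fermionic (m : nat) (alpha : seq nat) (k : intpart) : {poly int} :=
  if alpha is r :: alpha' then
    \sum_(b : bounded_partition m | (weight b + r == weight k)%N)
      hstrip ('X : {poly int}) (pad m b) (pad m k) * fermionic m alpha' b
  else (weight k == 0%N)%:R.

Lemma fermionic_cons m r alpha k : fermionic m (r :: alpha) k =
  \sum_(b : bounded_partition m | (weight b + r == weight k)%N)
    hstrip 'X (pad m b) (pad m k) * fermionic m alpha b.
Proof. by []. Qed.

(** The Pieri rule iterated from $P_\emptyset=1$. It is phrased in column lengths, so the induction
    runs over the conjugates [k]. *)
Lemma hsymm_prod N m alpha : (sumn alpha <= m)%N ->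
  \prod_(r <- alpha) hsymm (@var N) r =
  \sum_(p : bounded_partition m | (weight p == sumn alpha) && (size p <= N)%N)
    cst N (fermionic m alpha (conj_partition p)) * hall_littlewood N p.
Proof.
move=> le_m.
transitivity (\sum_(k : bounded_partition m |
    (weight k == sumn alpha) && (part k 0 <= N)%N)
    cst N (fermionic m alpha k) * hlP (cst N 'X) (@var N) (pad m k)); last first.
  rewrite (reindex_inj (can_inj (@bconjK m))); apply: eq_big => [p | p].
    by rewrite /= weight_conj part_conj0.
  move=> /andP[_ le_pN]; rewrite (@hall_littlewoodE _ _ m) ?bpartP //.
  by rewrite -part_conj0.
elim: alpha le_m => [|r alpha IH] le_m; rewrite [sumn _]/= in le_m *.
  have weight0 : (weight empty_partition <= m)%N by [].
  rewrite big_nil (big_pred1 (BoundedPartition weight0)).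
    rewrite /= rmorph1 mul1r (_ : pad m _ = nseq m.+1 0%N).
      by rewrite hlP_nseq0 ?cst_X_neq1 ?qfact_cst_neq0 //;
        [apply: var_inj | apply: var_neq0].
    apply: (@eq_from_nth _ 0%N); rewrite ?size_pad ?size_nseq // => i lt_im.
    by rewrite nth_mkseq // nth_nseq lt_im /part /= nth_nil.
  move=> k /=; apply/andP/eqP => [[/eqP weight_k _] | -> //].
  apply/val_inj/intpart_eq => i; have := part_le_weight k i.
  by rewrite weight_k leqn0 => /eqP->; rewrite /part /= nth_nil.
rewrite big_cons IH; last by apply: leq_trans le_m; rewrite leq_addl.
rewrite mulr_sumr.
transitivity (\sum_(b : bounded_partition m |
     (weight b == sumn alpha) && (part b 0 <= N)%N)
   \sum_(k : bounded_partition m |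
     (weight k == r + sumn alpha)%N && (part k 0 <= N)%N)
   cst N (hstrip 'X (pad m b) (pad m k) * fermionic m alpha b) *
   hlP (cst N 'X) (@var N) (pad m k)).
  apply: eq_bigr => b /andP[/eqP weight_b le_bN].
  have lt_m : (sumn (pad m b) + r < m.+1)%N.
    by rewrite sumn_pad ?bpartP // ltnS weight_b addnC.
  have pieri := hlP_pieri (qfact_cst_neq0 N) (@var_inj N) (cst_two_neq0 N)
    (path_pad m le_bN) (size_pad m b) lt_m.
  rewrite mulrCA pieri.
  rewrite sumn_pad ?bpartP // weight_b (addnC (sumn alpha)) big_cols_bounded //.
  rewrite mulr_sumr; apply: eq_bigr => k _.
  by rewrite rmorphM rmorph_hstrip mulrA (mulrC (cst N _)).
rewrite exchange_big; apply: eq_bigr => k /andP[/eqP weight_k le_kN].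
rewrite fermionic_cons rmorph_sum mulr_suml big_mkcond [RHS]big_mkcond; apply: eq_bigr => b _.
rewrite weight_k (addnC _ r) eqn_add2l.
case: eqP => [_|]; rewrite ?andFb ?andTb //; case: leqP => // lt_Nb.
(* Since [b] is a conjugate, [part b 0] is the number of rows of the index of $P$. An index with
   more than [N] rows is not contained in one with at most [N], so these extra terms of [fermionic]
   vanish. *)
have -> : hstrip ('X : {poly int}) (pad m b) (pad m k) = 0.
  by rewrite /= [(part b 0 <= _)%N]leqNgt (leq_ltn_trans le_kN lt_Nb) mul0r.
by rewrite mul0r rmorph0 mul0r.
Qed.

(** * Jacobi-Trudi and the existence of Kostka-Foulkes polynomials *)

Definition alternant (R : comNzRingType) N (x : 'I_N -> R) (f : nat -> nat) : R :=
  \det (\matrix_(i < N, j < N) x i ^+ (f j + (N - j.+1))%N).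

Lemma rmorph_alternant (R S : comNzRingType) (g : {rmorphism R -> S}) N
  (x : 'I_N -> R) f : g (alternant x f) = alternant (fun i => g (x i)) f.
Proof.
rewrite /alternant -det_map_mx; congr (\det _); apply/matrixP => i j.
by rewrite !mxE rmorphXn.
Qed.

(** Reversing both the rows and the columns preserves the determinant and turns the decreasing
    exponents into the increasing ones of [Vandermonde]. *)
Lemma alternant0E (R : comNzRingType) N (x : 'I_N -> R) :
  alternant x (fun=> 0%N) = \prod_(i < N) \prod_(j < N | (i < j)%N) (x i - x j).
Proof.
pose A := \matrix_(i < N, j < N) x i ^+ (0 + (N - j.+1))%N.
pose rv := perm (@rev_ord_inj N).
have -> : alternant x (fun=> 0%N) = \det (row_perm rv (col_perm rv A)).
  rewrite row_permE col_permE !det_mulmx !det_perm mulrCA.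
  by rewrite odd_permV -expr2 sqrr_sign mulr1.
have -> : row_perm rv (col_perm rv A) = (Vandermonde N (\row_j x (rev_ord j)))^T.
  apply/matrixP => i j; rewrite !mxE !permE /=; congr (_ ^+ _).
  by have := ltn_ord j; lia.
rewrite det_tr det_Vandermonde !pair_big_dep.
rewrite [RHS](reindex (fun p : 'I_N * 'I_N => (rev_ord p.2, rev_ord p.1))) /=.
  apply: eq_big => [[i j] | [i j] _] /=; last by rewrite !mxE.
  by have := ltn_ord i; have := ltn_ord j; lia.
by exists (fun p : 'I_N * 'I_N => (rev_ord p.2, rev_ord p.1)) => [[i j] | [i j]] _;
  rewrite /= !rev_ordK.
Qed.

Lemma alternant_perm (R : comNzRingType) N (x : 'I_N -> R) f (w : 'S_N) :
  alternant (fun i => x (w i)) f = (-1) ^+ w * alternant x f.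
Proof.
rewrite /alternant -det_perm -det_mulmx -row_permE; congr (\det _).
by apply/matrixP => i j; rewrite !mxE.
Qed.

Section JacobiTrudi.

Variables (F : fieldType) (N : nat) (x : 'I_N -> F).

Lemma elem_hsymm r :
  \sum_(0 <= k < r.+1) (elem_poly x)`_k * hsymm x (r - k) = (r == 0%N)%:R.
Proof.
case: r => [|r]; first by rewrite big_nat1 elem_poly0 mul1r.
rewrite big_nat_recl //= elem_poly0 mul1r subn0 /hsymm inverse_seriesS addrC.
by rewrite subrr.
Qed.

Definition elem_poly_but (k : 'I_N) : {poly F} :=
  \prod_(i < N | i != k) (1 - (x i)%:P * 'X).

(** In generating series, $\prod_{i\ne k}(1-x_iX)\cdot\sum_r h_rX^r=1/(1-x_kX)$. *)
Lemma elem_poly_but_hsymm k r :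
  \sum_(0 <= l < r.+1) (elem_poly_but k)`_l * hsymm x (r - l) = x k ^+ r.
Proof.
have elemE : elem_poly x = elem_poly_but k - (x k *: elem_poly_but k) * 'X.
  rewrite /elem_poly (bigD1 k) //= -/(elem_poly_but k) -mul_polyC.
  by rewrite mulrBl mul1r mulrAC.
elim: r => [|r IHr].
  by have := elem_hsymm 0; rewrite !big_nat1 elemE coefB coefMX subr0.
have := elem_hsymm r.+1; rewrite exprS -IHr mulr_sumr => /eqP.
rewrite [X in X == _]big_nat_recl //= elemE coefB coefMX subr0.
under eq_bigr do rewrite coefB coefMX /= coefZ mulrBl subSS -mulrA.
rewrite sumrB addrA subr_eq0 => /eqP <-.
by rewrite [LHS]big_nat_recl.
Qed.

Lemma size_elem_poly_but k : (size (elem_poly_but k) <= N)%N.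
Proof.
apply: leq_trans (size_prod_leq _ _) _.
have le2 i : (size (1 - (x i)%:P * 'X)%R <= 2)%N.
  rewrite (leq_trans (size_polyD _ _)) // geq_max size_poly1 size_polyN.
  by rewrite (leq_trans (size_polyMleq _ _)) // size_polyX size_polyC addn2; case: eqP.
have cardP : #|[pred i : 'I_N | i != k]| = N.-1.
  by have := cardC1 k; rewrite card_ord => <-; apply: eq_card.
rewrite (leq_trans (leq_sub2r _ (_ : _ <= (N.-1 * 2).+1)%N)) //; last first.
  by rewrite cardP; have := ltn_ord k; lia.
rewrite ltnS -cardP -sum_nat_const; exact: leq_sum.
Qed.

Definition hshift (a b : nat) : F := if (b <= a)%N then hsymm x (a - b) else 0.

Definition jacobi_trudi (k : nat) (f : nat -> nat) : 'M[F]_k :=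
  \matrix_(i, j) hshift (f i + j) i.

(** By [elem_poly_but_hsymm] the matrix of the alternant is a product of two matrices, the first of
    which does not depend on [f]. *)
Lemma alternant_jacobi_trudi f : alternant x f =
  \det (\matrix_(k < N, j < N) (elem_poly_but k)`_(N - j.+1)) *
  \det (jacobi_trudi N f).
Proof.
rewrite -[\det (jacobi_trudi _ _)]det_tr -det_mulmx; congr (\det _).
apply/matrixP => k i; rewrite !mxE; set r := (f i + _)%N.
pose G l := (elem_poly_but k)`_l * (if (l <= r)%N then hsymm x (r - l) else 0).
have widen a b : (forall l, (a <= l)%N -> G l = 0) ->
    \sum_(0 <= l < a) G l = \sum_(0 <= l < a + b) G l.
  move=> G0; rewrite (@big_cat_nat _ _ _ a 0 (a + b)) ?leq_addr //=.
  rewrite [X in _ = _ + X]big1_seq ?addr0 // => l.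
  by rewrite mem_index_iota => /andP[_ /andP[/G0]].
transitivity (\sum_(0 <= l < r.+1) G l).
  rewrite -elem_poly_but_hsymm !big_nat; apply: eq_bigr => l /andP[_].
  by rewrite /G ltnS => ->.
(* The sums of [r.+1] and of [N] terms are both extended to [r.+1 + N] terms: the extra ones vanish
   because $h$ is 0 at negative indices and [elem_poly_but k] has degree below [N]. *)
rewrite (widen _ N); last by move=> l lt_rl; rewrite /G leqNgt lt_rl mulr0.
rewrite addnC -widen; last first.
  move=> l le_Nl; rewrite /G nth_default ?mul0r //.
  exact: leq_trans (size_elem_poly_but k) le_Nl.
rewrite big_mkord (reindex_inj rev_ord_inj); apply: eq_bigr => j _.
rewrite !mxE /G /hshift /=; congr (_ * _).
have := ltn_ord i; have := ltn_ord j => lt_j lt_i.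
have -> : (N - j.+1 <= r)%N = (i <= f i + j)%N by rewrite /r; lia.
by case: ifP => // le_i; congr (hsymm _ _); rewrite /r; lia.
Qed.

Lemma det_hshift_unitriangular k a :
  \det (\matrix_(i < k, j < k) hshift (a + j) (a + i)) = 1.
Proof.
rewrite -det_tr det_trig; last first.
  by apply/is_trig_mxP => i j lt_ij; rewrite !mxE /hshift leq_add2l leqNgt lt_ij.
by rewrite big1 // => i _; rewrite !mxE /hshift leqnn subnn.
Qed.

(** Rows beyond the length of [p] are those of a unitriangular matrix, so the larger matrix is block
    triangular and the new diagonal block has determinant 1. *)
Lemma det_jacobi_trudi (p : intpart) k l : (size p <= k)%N ->
  \det (jacobi_trudi (k + l) (part p)) = \det (jacobi_trudi k (part p)).
Proof.
move=> le_pk; rewrite -[jacobi_trudi (k + l) _]submxK.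
have part0 i : (k <= i)%N -> part p i = 0%N.
  by move=> le_ki; apply/eqP; rewrite part_eq0 (leq_trans le_pk).
have -> : dlsubmx (jacobi_trudi (k + l) (part p)) = 0.
  apply/matrixP => i j; rewrite !mxE /= part0 ?leq_addr // /hshift leqNgt.
  by rewrite add0n ltn_addr.
rewrite det_ublock [X in _ * X](_ : _ = 1) ?mulr1.
  by congr (\det _); apply/matrixP => i j; rewrite !mxE.
rewrite -(det_hshift_unitriangular l k); congr (\det _).
by apply/matrixP => i j; rewrite !mxE /= part0 ?leq_addr.
Qed.

End JacobiTrudi.

Lemma alternant_var_neq0 N : alternant (@var N) (fun=> 0%N) != 0.
Proof.
rewrite alternant0E; apply/prodf_neq0 => i _; apply/prodf_neq0 => j lt_ij.
by rewrite subr_eq0 (inj_eq (@var_inj N)) -val_eqE /= ltn_eqF.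
Qed.

Lemma schurE N p : schur N p = alternant (@var N) (part p) / alternant (@var N) (fun=> 0%N).
Proof. by []. Qed.

(** In the quotient of alternants the common first factor cancels, and the Jacobi-Trudi determinant
    of the denominator is 1. As [k] is independent of [N], the coefficients obtained from it serve
    for every number of variables. *)
Lemma schur_jacobi_trudi N (p : intpart) k : (size p <= N)%N -> (size p <= k)%N ->
  schur N p = \det (jacobi_trudi (@var N) k (part p)).
Proof.
move=> le_pN le_pk.
have stable l : (size p <= l)%N ->
    \det (jacobi_trudi (@var N) l (part p)) =
    \det (jacobi_trudi (@var N) (size p) (part p)).
  by move=> le_pl; rewrite -(subnKC le_pl) det_jacobi_trudi.
rewrite (stable _ le_pk) -(stable _ le_pN) schurE alternant_jacobi_trudi.
have := alternant_var_neq0 N; rewrite [alternant _ (fun=> 0%N)]alternant_jacobi_trudi.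
rewrite [\det (jacobi_trudi _ _ (fun=> 0%N))](_ : _ = 1) ?mulr1.
  by move=> nz; rewrite mulrAC divff ?mul1r.
by rewrite -(det_hshift_unitriangular (@var N) N 0).
Qed.

(* p + delta - w(delta), a composition when jt_valid holds (the subtraction in *)
(* jt_comp is truncated otherwise).                                            *)
Definition jt_valid (k : nat) (p : intpart) (w : 'S_k) : bool :=
  [forall i : 'I_k, (i <= part p i + w i)%N].

Definition jt_comp (k : nat) (p : intpart) (w : 'S_k) : seq nat :=
  [seq (part p i + w i - i)%N | i : 'I_k <- enum 'I_k].

Lemma sumn_jt_comp k (p : intpart) (w : 'S_k) : (size p <= k)%N -> jt_valid p w ->
  sumn (jt_comp p w) = weight p.
Proof.
move=> le_pk /forallP valid_w; rewrite (weightE le_pk) sumnE big_map big_enum /=.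
apply/eqP; rewrite -(eqn_add2r (\sum_(i < k) i)) -big_split /=.
under eq_bigr => i _ do rewrite subnK ?valid_w //.
by rewrite big_split /= eqn_add2l [X in _ == X](reindex_inj (@perm_inj _ w)).
Qed.

Lemma det_jacobi_trudi_comp N k p :
  \det (jacobi_trudi (@var N) k (part p)) =
  \sum_(w : 'S_k | jt_valid p w)
    (-1) ^+ w * \prod_(r <- jt_comp p w) hsymm (@var N) r.
Proof.
rewrite [RHS]big_mkcond; apply: eq_bigr => w _; case: ifP => [/forallP valid_w|].
  congr (_ * _); rewrite big_map big_enum; apply: eq_bigr => i _.
  by rewrite mxE /hshift valid_w.
move/negbT; rewrite negb_forall => /existsP[i /negPf inv_i].
by rewrite (bigD1 i) //= mxE /hshift inv_i mul0r mulr0.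
Qed.

(** The entry of $JA(q)$ at [(p, r)], the explicit candidate for the Kostka-Foulkes polynomial. *)
Definition jt_coef (k : nat) (p r : intpart) : {poly int} :=
  \sum_(w : 'S_k | jt_valid p w)
    (-1) ^+ w * fermionic (weight p) (jt_comp p w) (conj_partition r).

Lemma schur_hall_littlewood m N (p : intpart) k : weight p = m ->
  (size p <= N)%N -> (size p <= k)%N ->
  schur N p =
  \sum_(r : bounded_partition m | (weight r == m) && (size r <= N)%N)
    cst N (jt_coef k p r) * hall_littlewood N r.
Proof.
case: m / => le_pN le_pk; rewrite (schur_jacobi_trudi le_pN le_pk) det_jacobi_trudi_comp.
under eq_bigr => w valid_w.
  rewrite (@hsymm_prod N (weight p)) ?sumn_jt_comp // mulr_sumr.
  over.
rewrite exchange_big; apply: eq_bigr => r _.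
rewrite rmorph_sum mulr_suml; apply: eq_bigr => w _.
by rewrite rmorphM rmorph_sign mulrA.
Qed.

(** [kostka_foulkes] is picked by [epsilon], so it has its defining property as soon as one witness
    exists. *)
Lemma is_kostka_foulkes_jt : is_kostka_foulkes
  (fun p r => if weight p == weight r then jt_coef (size p) p r else 0).
Proof.
split=> [p r /eqP/negPf-> // | N p le_pN].
rewrite (schur_hall_littlewood erefl le_pN (leqnn _)).
by apply: eq_bigr => r /andP[/eqP-> _]; rewrite eqxx.
Qed.

Lemma kostka_foulkesP : is_kostka_foulkes kostka_foulkes.
Proof.
apply: ClassicalEpsilon.epsilon_spec; eexists; exact: is_kostka_foulkes_jt.
Qed.

Lemma schur_kostka_foulkes m N (p : intpart) : weight p = m -> (size p <= N)%N ->
  schur N p =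
  \sum_(r : bounded_partition m | (weight r == m) && (size r <= N)%N)
    cst N (kostka_foulkes p r) * hall_littlewood N r.
Proof. by case: m / => le_pN; case: kostka_foulkesP => _ ->. Qed.

(** * Linear independence and the specialization q = 1 *)

Lemma perm_increasing N (w : 'S_N) :
  (forall i j : 'I_N, (i < j)%N -> (w i < w j)%N) -> w = 1%g.
Proof.
have le_incr (v : 'S_N) : (forall i j : 'I_N, (i < j)%N -> (v i < v j)%N) ->
    forall i : 'I_N, (i <= v i)%N.
  move=> v_incr [i lt_iN] /=; elim: i lt_iN => // i IHi lt_iN.
  by apply: leq_ltn_trans (IHi (ltnW lt_iN)) (v_incr _ _ _) => /=.
move=> w_incr; apply/permP => i; rewrite perm1; apply/val_inj/eqP.
rewrite /= eqn_leq le_incr // andbT.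
have := le_incr w^-1%g _ (w i); rewrite permK; apply=> a b lt_ab.
rewrite ltnNge leq_eqVlt; apply/norP; split.
  by rewrite (inj_eq val_inj) (inj_eq perm_inj) -val_eqE gtn_eqF.
apply/negP => /w_incr; rewrite !permKV => lt_ba.
by have := ltn_trans lt_ab lt_ba; rewrite ltnn.
Qed.

Lemma mcoeff_alternant (R : comNzRingType) N f (e : 'X_{1..N}) :
  (alternant (fun i => 'X_i : {mpoly R[N]}) f)@_e =
  \sum_(w : 'S_N)
    (-1) ^+ w * [forall i : 'I_N, e i == (f (w i) + (N - (w i).+1))%N]%:R.
Proof.
rewrite /alternant /determinant raddf_sum; apply: eq_bigr => w _ /=.
rewrite !mulr_sign.
have -> : \prod_(i < N) (\matrix_(i0, j) ('X_i0 : {mpoly R[N]}) ^+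
    (f j + (N - j.+1))) i (w i) = 'X_[[multinom (f (w i) + (N - (w i).+1))%N | i < N]].
  by rewrite mpolyXE_id; apply: eq_bigr => i _; rewrite mxE mnmE.
have -> : [forall i : 'I_N, e i == (f (w i) + (N - (w i).+1))%N] =
    ([multinom (f (w i) + (N - (w i).+1))%N | i < N] == e).
  apply/forallP/eqP => [e_w | <- i]; last by rewrite mnmE.
  by apply/mnmP => i; rewrite mnmE (eqP (e_w i)).
by case: (odd_perm w); rewrite ?mcoeffN mcoeffX.
Qed.

Definition delta_shift N (p : intpart) : 'X_{1..N} :=
  [multinom (part p i + (N - i.+1))%N | i < N].

(** The exponents $p+\delta$ and $r+\delta$ are both strictly decreasing, so a permutation matching
    them is increasing, hence the identity. *)
Lemma mcoeff_alternant_shift (R : comNzRingType) N (p r : intpart) :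
  (size p <= N)%N -> (size r <= N)%N ->
  (alternant (fun i => 'X_i : {mpoly R[N]}) (part p))@_(delta_shift N r) = (p == r)%:R.
Proof.
move=> le_pN le_rN; rewrite mcoeff_alternant.
have shift_anti (s : intpart) (i j : 'I_N) : (i <= j)%N ->
    (part s j + (N - j.+1) <= part s i + (N - i.+1))%N.
  by move=> le_ij; rewrite leq_add ?part_le // leq_sub2l.
pose hit (w : 'S_N) :=
  [forall i : 'I_N, delta_shift N r i == (part p (w i) + (N - (w i).+1))%N].
have hit1 w : hit w -> w = 1%g.
  move=> /forallP rw; apply: perm_increasing => i j lt_ij.
  rewrite ltnNge; apply/negP => /(shift_anti p).
  rewrite -(eqP (rw i)) -(eqP (rw j)) !mnmE.
  have := part_le r (ltnW lt_ij); have := ltn_ord j; lia.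
have [eq_pr | neq_pr] := eqVneq p r.
  rewrite (bigD1 1%g) //= big1 ?addr0 => [|w neq_w1]; last first.
    rewrite -/(hit w); case: (boolP (hit w)) => [/hit1 w1 | _]; last by rewrite mulr0.
    by rewrite w1 eqxx in neq_w1.
  rewrite odd_perm1 mul1r -/(hit 1%g); have -> : hit 1%g.
    by apply/forallP => i; rewrite mnmE perm1 eq_pr.
  by [].
rewrite big1 // => w _; rewrite -/(hit w).
case: (boolP (hit w)) => [hw | _]; last by rewrite mulr0.
have rw := hw; rewrite (hit1 w hw) in rw.
case/eqP: neq_pr; apply: intpart_eq => i.
have [lt_iN | le_Ni] := ltnP i N.
  have := forallP rw (Ordinal lt_iN); rewrite mnmE perm1 /=.
  by rewrite eqn_add2r => /eqP.
have part0 (s : intpart) : (size s <= N)%N -> part s i = 0%N.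
  by move=> le_sN; apply/eqP; rewrite part_eq0 (leq_trans le_sN).
by rewrite !part0.
Qed.

Section Independence.

Variables (m N : nat).
Hypothesis le_mN : (m <= N)%N.

Let le_size (p : bounded_partition m) : (size p <= N)%N.
Proof. exact: leq_trans (size_le_weight p) (leq_trans (bpartP p) le_mN). Qed.

Lemma alternant_free (R : comNzRingType) (A : {pred bounded_partition m})
    (u : bounded_partition m -> R) :
  \sum_(p in A) mpolyC N (u p) * alternant (fun i => 'X_i) (part p) = 0 ->
  forall r, r \in A -> u r = 0.
Proof.
move=> sum0 r A_r.
pose a (p : bounded_partition m) : {mpoly R[N]} := alternant (fun i => 'X_i) (part p).
have a_r p : (a p)@_(delta_shift N r) = (p == r)%:R by apply: mcoeff_alternant_shift.
have {}sum0 : \sum_(p in A) mpolyC N (u p) * a p = 0 by exact: sum0.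
(* The determinants are abstracted: unification would try to unfold them. *)
move: a a_r sum0 => a a_r /(congr1 (mcoeff (delta_shift N r))).
rewrite mcoeff0 (raddf_sum (mcoeff _)) (bigD1 r) //= mcoeffCM a_r eqxx mulr1.
by rewrite big1 ?addr0 // => p /andP[_ neq_pr]; rewrite mcoeffCM a_r (negPf neq_pr) mulr0.
Qed.

Lemma tofrac_alternant p :
  alternant (@var N) (part p) = tofrac (alternant (fun i => 'X_i) (part p)).
Proof. by rewrite rmorph_alternant. Qed.

Lemma schur_free (A : {pred bounded_partition m}) (u : bounded_partition m -> {poly int}) :
  \sum_(p in A) cst N (u p) * schur N p = 0 -> forall p, p \in A -> u p = 0.
Proof.
move=> sum0 r A_r.
apply: (@alternant_free _ A u _ r A_r).
apply/eqP; rewrite -tofrac_eq0; apply/eqP.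
transitivity ((\sum_(p in A) cst N (u p) * schur N p) *
    alternant (@var N) (fun=> 0%N)); last by rewrite sum0 mul0r.
rewrite rmorph_sum mulr_suml; apply: eq_bigr => p _; rewrite rmorphM -mulrA.
congr (_ * _).
by rewrite schurE divfK ?alternant_var_neq0 // tofrac_alternant.
Qed.

(* The s_p and the P_r are equinumerous, so the independence of the former,    *)
(* which lie in the span of the latter, entails that of the latter.            *)
Lemma hall_littlewood_free (c : bounded_partition m -> {poly int}) :
  \sum_(r : bounded_partition m | weight r == m) cst N (c r) * hall_littlewood N r = 0 ->
  forall r : bounded_partition m, weight r = m -> c r = 0.
Proof.
pose A := [pred r : bounded_partition m | weight r == m].
move=> sum0 r /eqP A_r.
pose K : 'M[{poly int}]_#|A| :=
  \matrix_(i < #|A|, j < #|A|) jt_coef (size (enum_val i)) (enum_val i) (enum_val j).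
pose H : 'cV[ratfun N]_#|A| := \col_(j < #|A|) hall_littlewood N (enum_val j).
have schur_K (u : 'rV[{poly int}]_#|A|) : map_mx (cst N) (u *m K) *m H = 0 -> u = 0.
  move=> uKH; apply/rowP => i; rewrite mxE.
  have := @schur_free A (fun p => u 0 (enum_rank_in A_r p)) _ (enum_val i) (enum_valP i).
  rewrite enum_valK_in; apply.
  have E : (map_mx (cst N) u *m (map_mx (cst N) K *m H)) 0 0 = 0.
    by rewrite mulmxA -map_mxM uKH mxE.
  rewrite mxE in E; rewrite big_enum_val; apply: etrans E.
  apply: eq_bigr => k _; rewrite !mxE enum_valK_in; congr (_ * _).
  have /eqP weight_k : enum_val k \in A by apply: enum_valP.
  rewrite (schur_hall_littlewood weight_k (le_size _) (leqnn _)).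
  transitivity (\sum_(r in A) cst N (jt_coef (size (enum_val k)) (enum_val k) r) *
     hall_littlewood N r).
    by apply: eq_bigl => s; rewrite le_size andbT.
  by rewrite big_enum_val; apply: eq_bigr => l _; rewrite !mxE.
have detK : \det K != 0.
  apply/negP => /det0P[u u_neq0 uK].
  by case/eqP: u_neq0; apply: schur_K; rewrite uK map_mx0 mul0mx.
pose C : 'rV[{poly int}]_#|A| := \row_(j < #|A|) c (enum_val j).
have CH : map_mx (cst N) C *m H = 0.
  apply/matrixP => i j; rewrite !mxE -[RHS]sum0.
  transitivity (\sum_(r in A) cst N (c r) * hall_littlewood N r).
    by rewrite [RHS]big_enum_val; apply: eq_bigr => l _; rewrite !mxE.
  by apply: eq_bigl.
(* Multiplying by the adjugate instead of inverting [K] keeps the coefficients polynomial in $q$: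
   the relation becomes $\det K$ times the given one, now expressed in Schur functions. *)
have CadjK : C *m \adj K = 0.
  apply: schur_K; rewrite -mulmxA mul_adj_mx mul_mx_scalar map_mxZ -scalemxAl CH.
  by rewrite scaler0.
have C0 : C = 0.
  apply: (scalemx_inj detK); rewrite scaler0 -mul_mx_scalar -mul_adj_mx mulmxA.
  by rewrite CadjK mul0mx.
have := congr1 (fun M : 'rV_#|A| => M 0 (enum_rank_in A_r r)) C0.
by rewrite !mxE enum_rankK_in.
Qed.

End Independence.

(** Both are coefficients of the same Schur function in [m] variables, where the $P_r$ are
    independent. The free [k] later allows a single symmetric group for all partitions with at most
    [n] parts. *)
Lemma kostka_foulkes_jt m k (p r : intpart) : weight p = m -> weight r = m ->
  (size p <= k)%N -> kostka_foulkes p r = jt_coef k p r.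
Proof.
move=> weight_p weight_r le_pk; apply/eqP; rewrite -subr_eq0; apply/eqP.
have le_size (s : bounded_partition m) : (size s <= m)%N.
  exact: leq_trans (size_le_weight s) (bpartP s).
have le_pm : (size p <= m)%N by rewrite -weight_p size_le_weight.
have br : (weight r <= m)%N by rewrite weight_r.
apply: (@hall_littlewood_free m m (leqnn m)
  (fun s => kostka_foulkes p s - jt_coef k p s) _ (BoundedPartition br) weight_r).
under eq_bigr do rewrite rmorphB mulrBl.
rewrite sumrB; apply/eqP; rewrite subr_eq0; apply/eqP.
transitivity (schur m p).
  by rewrite (schur_kostka_foulkes weight_p) //; apply: eq_bigl => s;
    rewrite le_size andbT.
by rewrite (schur_hall_littlewood weight_p le_pm le_pk); apply: eq_bigl => s;
  rewrite le_size andbT.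
Qed.

(** The iterated Pieri coefficients depend visibly on the order of the factors; uniqueness of the
    expansion in the $P_r$ shows that only the product matters. *)
Lemma fermionic_prod m alpha beta (r : intpart) :
  sumn alpha = m -> sumn beta = m -> weight r = m ->
  \prod_(i <- alpha) hsymm (@var m) i = \prod_(i <- beta) hsymm (@var m) i ->
  fermionic m alpha (conj_partition r) = fermionic m beta (conj_partition r).
Proof.
move=> sum_a sum_b weight_r prodE; apply/eqP; rewrite -subr_eq0; apply/eqP.
have br : (weight r <= m)%N by rewrite weight_r.
apply: (@hall_littlewood_free m m (leqnn m) (fun s =>
  fermionic m alpha (conj_partition s) - fermionic m beta (conj_partition s))
  _ (BoundedPartition br) weight_r).
under eq_bigr do rewrite rmorphB mulrBl.
rewrite sumrB; apply/eqP; rewrite subr_eq0; apply/eqP.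
have le_size (s : bounded_partition m) : (size s <= m)%N.
  exact: leq_trans (size_le_weight s) (bpartP s).
have := prodE; rewrite (@hsymm_prod m m) ?sum_a // (@hsymm_prod m m) ?sum_b //.
have sumE (G : bounded_partition m -> ratfun m) :
    \sum_(s : bounded_partition m | (weight s == m) && (size s <= m)%N) G s =
    \sum_(s : bounded_partition m | weight s == m) G s.
  by apply: eq_bigl => s; rewrite le_size andbT.
by rewrite !sumE.
Qed.

Lemma weight_partition_of (s : seq nat) : weight (partition_of s) = sumn s.
Proof.
rewrite /weight /= (perm_sumn (permEl (perm_sort _ _))).
by elim: s => //= x s <-; case: eqP => [->|].
Qed.

Lemma fermionic_sorted m alpha (r : intpart) : sumn alpha = m -> weight r = m ->
  fermionic m (partition_of alpha) (conj_partition r) =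
  fermionic m alpha (conj_partition r).
Proof.
move=> sum_a weight_r; apply: fermionic_prod => //.
  by rewrite -[LHS]/(weight _) weight_partition_of.
rewrite (perm_big _ (permEl (perm_sort _ _))) /= big_filter big_mkcond /=.
by apply: eq_bigr => i _; case: eqP => [->|].
Qed.

Lemma fermionic_rev m alpha (r : intpart) : sumn alpha = m -> weight r = m ->
  fermionic m (rev alpha) (conj_partition r) = fermionic m alpha (conj_partition r).
Proof.
move=> sum_a weight_r; apply: fermionic_prod; rewrite ?sumn_rev //.
by apply: perm_big; rewrite perm_rev.
Qed.

(** * Counting rearrangements, and Hall-Littlewood polynomials at $q=1$ *)

Definition fmult n (f : 'I_n -> nat) (a : nat) : nat := (\sum_(i < n) (f i == a))%N.

Lemma fmult_count n (f : 'I_n -> nat) a :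
  fmult f a = count_mem a [seq f i | i <- enum 'I_n].
Proof.
rewrite count_map -sum1_count big_enum_cond /= /fmult [RHS]big_mkcond /=.
by apply: eq_bigr => i _; case: eqP.
Qed.

(** Induction on [n]: the value [g ord0] can be matched at [fmult f (g ord0)] positions, and
    removing one of them lowers that factorial by one step. *)
Lemma card_perm_match n B (f g : 'I_n -> nat) :
  (forall i, g i < B)%N -> (forall a, fmult f a = fmult g a) ->
  (\sum_(w : 'S_n) [forall i, f (w i) == g i])%N =
  (\prod_(0 <= a < B) (fmult g a)`!)%N.
Proof.
elim: n f g => [|n IHn] f g lt_gB fg.
  rewrite [RHS]big1 => [|a _]; last by rewrite /fmult big_ord0.
  rewrite (bigD1 1%g) //= big1 => [|w /eqP[]]; last by apply/permP => - [].
  by rewrite addn0; have -> : [forall i, f ((1%g : 'S_0) i) == g i] by apply/forallP => - [].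
rewrite sum_lift_perm.
have fmultD (h : 'I_n.+1 -> nat) k a :
    fmult h a = ((h k == a) + fmult (fun i => h (lift k i)) a)%N.
  by rewrite /fmult (bigD1_ord k).
transitivity (\sum_k (f k == g ord0) *
   \prod_(0 <= a < B) (fmult (fun i => g (lift ord0 i)) a)`!)%N.
  apply: eq_bigr => k _; have [eq_fg | neq_fg] := eqVneq (f k) (g ord0); last first.
    rewrite mul0n big1 // => s _; apply/eqP; rewrite eqb0 negb_forall.
    by apply/existsP; exists ord0; rewrite lift_perm_id.
  rewrite mul1n -(IHn (fun i => f (lift k i))) //; last first.
    by move=> a; have := fg a; rewrite (fmultD f k) (fmultD g ord0) eq_fg => /addnI.
  apply: eq_bigr => s _; congr nat_of_bool; apply/forallP/forallP => eq_s i.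
    by have := eq_s (lift ord0 i); rewrite lift_perm_lift.
  case: (unliftP ord0 i) => [j|] ->; last by rewrite lift_perm_id eq_fg.
  by rewrite lift_perm_lift.
rewrite -big_distrl /= -/(fmult f (g ord0)) fg.
rewrite !(bigD1_seq (g ord0)) ?iota_uniq ?mem_index_iota ?lt_gB //= mulnA.
congr (_ * _)%N; first by rewrite (fmultD g ord0) eqxx add1n factS.
by apply: eq_bigr => a neq_a; rewrite (fmultD g ord0) eq_sym (negPf neq_a).
Qed.

Lemma sum_perm_match n B (f g : 'I_n -> nat) : (forall i, f i < B)%N ->
  (\sum_(w : 'S_n) [forall i, f (w i) == g i])%N =
  (perm_eq [seq g i | i <- enum 'I_n] [seq f i | i <- enum 'I_n] *
   \prod_(0 <= a < B) (fmult f a)`!)%N.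
Proof.
move=> lt_fB; have [perm_gf | /negP not_gf] := boolP (perm_eq _ _).
  have fg a : fmult f a = fmult g a by rewrite !fmult_count (seq.permP perm_gf).
  rewrite mul1n (card_perm_match (B := B)) //; first by apply: eq_bigr => a _; rewrite fg.
  have : all (fun a => a < B)%N [seq g i | i <- enum 'I_n].
    by rewrite (perm_all _ perm_gf); apply/allP => _ /mapP[i _ ->].
  by move=> /allP lt_gB i; apply: lt_gB; rewrite map_f ?mem_enum.
rewrite mul0n big1 // => w _; apply/eqP; rewrite eqb0; apply/negP => /forallP w_fg.
apply: not_gf; apply/allP => a _ /=; rewrite -!fmult_count /fmult.
rewrite [X in _ == X](reindex_inj (@perm_inj _ w)); apply/eqP.
by apply: eq_bigr => i _; rewrite (eqP (w_fg i)).
Qed.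

Lemma partition_ofE n (s : intpart) (g : seq nat) : size g = n -> (size s <= n)%N ->
  (partition_of g == s) = perm_eq g [seq part s i | i : 'I_n <- enum 'I_n].
Proof.
move=> size_g le_sn.
have padE : [seq part s i | i : 'I_n <- enum 'I_n] = s ++ nseq (n - size s) 0%N.
  apply: (@eq_from_nth _ 0%N) => [|i].
    by rewrite size_map size_enum_ord size_cat size_nseq subnKC.
  rewrite size_map size_enum_ord => lt_in.
  rewrite (nth_map (Ordinal lt_in)) ?size_enum_ord // nth_enum_ord // nth_cat nth_nseq.
  by case: ltnP => // le_si; rewrite if_same /part nth_default.
have filter_s : filter (predC1 0%N) s = s.
  apply/all_filterP/allP => x x_s /=; have /andP[_ s0] := partsP s.
  by apply: contraNneq s0 => <-.
have geq_trans : transitive geq by move=> a b c /= le1 le2; apply: leq_trans le2 le1.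
have geq_total : total geq by move=> a b /=; apply: leq_total.
have geq_anti : antisymmetric geq by move=> a b /=; rewrite andbC => /anti_leq.
rewrite padE; apply/eqP/idP => [<- | perm_g].
  rewrite -(perm_filterC (predC1 0%N) g) perm_sym; apply: perm_cat.
    by rewrite perm_sort.
  set z := filter _ g; have -> : z = nseq (size z) 0%N.
    apply/all_pred1P; apply: sub_all (filter_all _ _) => a /=.
    by rewrite negbK.
  have /perm_size := permEl (perm_filterC (predC1 0%N) g).
  rewrite size_cat -/z size_g => <-.
  by rewrite /= size_sort addKn.
apply: val_inj => /=.
have -> : sort geq (filter (predC1 0%N) g) = sort geq s.
  apply/(perm_sortP geq_total geq_trans geq_anti).
  rewrite -filter_s; have := perm_filter (predC1 0%N) perm_g.
  by rewrite filter_cat filter_nseq /= cats0 filter_s.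
by apply: sorted_sort => //; apply: intpart_sorted.
Qed.

(** This is $a_\delta v_sP_s$ without denominators. Setting $q=1$ makes no sense in the fraction
    field, so identities are first cleared to polynomials of this kind and then specialized. *)
Definition hl_numerator (R : comNzRingType) N (x : 'I_N -> R) (q : R) (s : intpart) : R :=
  \sum_(w : 'S_N) (-1) ^+ w * (\prod_(i < N) x (w i) ^+ part s i) *
    \prod_(i < N) \prod_(j < N | (i < j)%N) (x (w i) - q * x (w j)).

Lemma rmorph_hl_numerator (R S : comNzRingType) (f : {rmorphism R -> S}) N
  (x : 'I_N -> R) q s :
  f (hl_numerator x q s) = hl_numerator (fun i => f (x i)) (f q) s.
Proof.
rewrite rmorph_sum; apply: eq_bigr => w _.
rewrite !rmorphM rmorph_sign !rmorph_prod; congr (_ * _ * _).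
  by apply: eq_bigr => i _; rewrite rmorphXn.
apply: eq_bigr => i _; rewrite rmorph_prod; apply: eq_bigr => j _.
by rewrite rmorphB rmorphM.
Qed.

Lemma eq_hl_numerator (R : comNzRingType) N (x y : 'I_N -> R) q s :
  x =1 y -> hl_numerator x q s = hl_numerator y q s.
Proof.
move=> xy; apply: eq_bigr => w _; congr (_ * _ * _).
  by apply: eq_bigr => i _; rewrite xy.
by apply: eq_bigr => i _; apply: eq_bigr => j _; rewrite !xy.
Qed.

Lemma eq_alternant (R : comNzRingType) N (x y : 'I_N -> R) f :
  x =1 y -> alternant x f = alternant y f.
Proof. by move=> xy; congr (\det _); apply/matrixP => i j; rewrite !mxE xy. Qed.

(** At $q=1$ the product over pairs is $a_\delta$ up to the sign of [w], which cancels the sign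
    already present. *)
Lemma hl_numerator1 (R : comNzRingType) N (x : 'I_N -> R) s :
  hl_numerator x 1 s =
  alternant x (fun=> 0%N) * \sum_(w : 'S_N) \prod_(i < N) x (w i) ^+ part s i.
Proof.
rewrite mulr_sumr; apply: eq_bigr => w _.
have -> : \prod_(i < N) \prod_(j < N | (i < j)%N) (x (w i) - 1 * x (w j)) =
    (-1) ^+ w * alternant x (fun=> 0%N).
  rewrite -alternant_perm alternant0E; apply: eq_bigr => i _.
  by apply: eq_bigr => j _; rewrite mul1r.
rewrite mulrACA -expr2 sqrr_sign mul1r mulrC.
by [].
Qed.

Lemma divf_sign (F : fieldType) (b : bool) (M Q a : F) : a != 0 ->
  M * (Q / ((-1) ^+ b * a)) * a = (-1) ^+ b * M * Q.
Proof.
by move=> a_neq0; rewrite invfM invr_sign; move: (_ ^+ b) => s; field.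
Qed.

Lemma hall_littlewood_numerator N s :
  hall_littlewood N s * alternant (@var N) (fun=> 0%N) =
  (cst N (vpart N s))^-1 * hl_numerator (@var N) (cst N 'X) s.
Proof.
rewrite /hall_littlewood -mulrA; congr (_ * _); rewrite mulr_suml.
apply: eq_bigr => w _; set M := \prod_(i < N) _ ^+ _.
have -> : \prod_(i < N) \prod_(j < N | (i < j)%N)
      ((var (w i) - cst N 'X * var (w j)) / (var (w i) - var (w j))) =
    (\prod_(i < N) \prod_(j < N | (i < j)%N) (var (w i) - cst N 'X * var (w j))) /
    ((-1) ^+ w * alternant (@var N) (fun=> 0%N)).
  rewrite -alternant_perm alternant0E -prodf_div; apply: eq_bigr => i _.
  by rewrite prodf_div.
exact: divf_sign (alternant_var_neq0 N).
Qed.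

Lemma horner_vpoly1 k : (vpoly k).[1] = k`!%:R.
Proof.
rewrite -[LHS]/(horner_eval (1 : int) (qfact 'X k)) rmorph_qfact.
rewrite /= /horner_eval hornerX; elim: k => [|k IHk]; first by rewrite qfact0.
rewrite qfactS IHk factS mulnC natrM; congr (_ * _).
rewrite /qint; under eq_bigr do rewrite expr1n.
by rewrite sumr_const_nat subn0.
Qed.

Lemma horner_vpart1 N p :
  (vpart N p).[1] = (\prod_(0 <= a < (part p 0).+1) (fmult (fun i : 'I_N => part p i) a)`!)%:R.
Proof.
rewrite /vpart horner_prod natr_prod; apply: eq_bigr => a _; rewrite horner_vpoly1.
rewrite /multiplicity /fmult -sum1dep_card big_mkcond; congr (_`!%:R).
Qed.

Lemma vpart_neq0 N p : vpart N p != 0.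
Proof.
apply: (big_ind (fun f : {poly int} => f != 0)) => [|f g f0 g0|i _].
- exact: oner_neq0.
- exact: mulf_neq0.
- exact: qfact_X_neq0.
Qed.

Lemma mcoeff_sign (R : nzRingType) N (b : bool) (f : {mpoly R[N]}) e :
  ((-1) ^+ b * f)@_e = (-1) ^+ b * f@_e.
Proof. by rewrite !mulr_sign; case: b; rewrite ?mcoeffN. Qed.

(** A term $w$ of $a_\delta$ leaves the exponent $r+\delta-w(\delta)$, that is [jt_comp r w], to be
    matched by a rearrangement of [s]. Each rearrangement arises from as many permutations as the
    stabilizer of [s] has elements, and this order is $v_s(1)$. *)
Lemma mcoeff_alternant_monomials N (r s : intpart) : (size s <= N)%N ->
  (alternant (fun i => 'X_i : {mpoly int[N]}) (fun=> 0%N) *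
    \sum_(v : 'S_N) \prod_(i < N) 'X_(v i) ^+ part s i)@_(delta_shift N r) =
  \sum_(w : 'S_N | jt_valid r w)
    (-1) ^+ w * ((partition_of (jt_comp r w) == s)%:R * (vpart N s).[1]).
Proof.
move=> le_sN; pose e (w : 'S_N) := [multinom (0 + (N - (w i).+1))%N | i < N].
pose es (v : 'S_N) := [multinom part s (v i) | i < N].
have -> : alternant (fun i => 'X_i : {mpoly int[N]}) (fun=> 0%N) =
    \sum_(w : 'S_N) (-1) ^+ w * 'X_[e w].
  apply: eq_bigr => w _; congr (_ * _); rewrite mpolyXE_id; apply: eq_bigr => i _.
  by rewrite mxE mnmE.
have -> : \sum_(v : 'S_N) \prod_(i < N) ('X_(v i) : {mpoly int[N]}) ^+ part s i =
    \sum_(v : 'S_N) 'X_[es v].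
  rewrite [RHS](reindex_inj invg_inj); apply: eq_bigr => v _.
  rewrite mpolyXE_id [RHS](reindex_inj (@perm_inj _ v)); apply: eq_bigr => i _.
  by rewrite mnmE permK.
rewrite mulr_suml raddf_sum [RHS]big_mkcond; apply: eq_bigr => w _ /=.
rewrite -mulrA mcoeff_sign mulr_sumr (raddf_sum (mcoeff _)) /=.
have hitE (v : 'S_N) : ('X_[e w] * 'X_[es v] : {mpoly int[N]})@_(delta_shift N r) =
    (jt_valid r w && [forall i, part s (v i) == (part r i + w i - i)%N])%:R.
  rewrite -mpolyXD mcoeffX; congr (nat_of_bool _)%:R.
  apply/eqP/andP => [ew | [/forallP valid_w /forallP eq_v]].
    have ewi (i : 'I_N) := congr1 (fun f : 'X_{1..N} => f i) ew.
    by split; apply/forallP => i; have := ewi i; rewrite mnmDE !mnmE => ewi';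
      have := ltn_ord i; have := ltn_ord (w i); lia.
  apply/mnmP => i; rewrite mnmDE !mnmE; have := valid_w i; have /eqP -> := eq_v i.
  by have := ltn_ord i; have := ltn_ord (w i); lia.
under eq_bigr do rewrite hitE.
case: ifP => [valid_w | _]; last by rewrite big1 ?mulr0.
congr (_ * _); rewrite -natr_sum.
have lt_s (i : 'I_N) : (part s i < (part s 0).+1)%N by rewrite ltnS part_le.
rewrite (sum_perm_match (f := fun i : 'I_N => part s i)
  (fun i : 'I_N => (part r i + w i - i)%N) lt_s).
have size_comp : size (jt_comp r w) = N by rewrite size_map size_enum_ord.
by rewrite natrM horner_vpart1 (partition_ofE size_comp le_sN).
Qed.

Lemma tofrac_hl_numerator n s : hl_numerator (@var n) (cst n 'X) s =
  tofrac (hl_numerator (fun i => 'X_i) (mpolyC n 'X) s).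
Proof. by rewrite rmorph_hl_numerator. Qed.

Lemma mulf_cancel_middle (F : fieldType) (v v' k h : F) : v != 0 ->
  v * v' * (k * (v^-1 * h)) = k * v' * h.
Proof. by move=> v_neq0; field. Qed.

(* Coefficient of x^(r + delta) in a_delta s_p = a_(p + delta) at q = 1, where *)
(* P_s becomes the monomial symmetric function m_s.                            *)
Lemma kostka_foulkes_inverse m n (p r : bounded_partition m) :
  weight p = m -> weight r = m -> (size p <= n)%N -> (size r <= n)%N ->
  \sum_(w : 'S_n | jt_valid r w)
    (-1) ^+ w * (kostka_foulkes p (partition_of (jt_comp r w))).[1] = (p == r)%:R.
Proof.
move=> weight_p weight_r le_pn le_rn.
(* [V] clears all denominators $v_s$ at once, [V' s] being the cofactor of $v_s$; it can be
   cancelled after specialization because $v_s(1)$ is a product of factorials. *)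
pose V : {poly int} := \prod_(s : bounded_partition m) vpart n s.
pose V' (s : bounded_partition m) : {poly int} :=
  \prod_(t : bounded_partition m | t != s) vpart n t.
have VE (s : bounded_partition m) : V = vpart n s * V' s by rewrite /V (bigD1 s).
pose A := [pred s : bounded_partition m | (weight s == m) && (size s <= n)%N].
have mpoly_eq : mpolyC n V * alternant (fun i => 'X_i) (part p) =
    \sum_(s in A) mpolyC n (kostka_foulkes p s * V' s) *
      hl_numerator (fun i => 'X_i) (mpolyC n 'X) s.
  apply/eqP; rewrite -tofrac_eq; apply/eqP.
  transitivity (cst n V * schur n p * alternant (@var n) (fun=> 0%N)).
    rewrite rmorphM -mulrA schurE divfK ?alternant_var_neq0 //.
    by rewrite tofrac_alternant.
  transitivity (\sum_(s in A) cst n V * (cst n (kostka_foulkes p s) *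
      hall_littlewood n s) * alternant (@var n) (fun=> 0%N)).
    by rewrite (schur_kostka_foulkes weight_p le_pn) -mulr_suml -mulr_sumr.
  rewrite rmorph_sum; apply: eq_bigr => s _.
  transitivity (cst n V * (cst n (kostka_foulkes p s) *
      ((cst n (vpart n s))^-1 * hl_numerator (@var n) (cst n 'X) s))).
    by rewrite -hall_littlewood_numerator !mulrA.
  transitivity (cst n (kostka_foulkes p s * V' s) *
      hl_numerator (@var n) (cst n 'X) s); last first.
    by rewrite [RHS]rmorphM tofrac_hl_numerator.
  by rewrite (VE s) !rmorphM mulf_cancel_middle // cst_eq0 vpart_neq0.
pose ev : {rmorphism {mpoly {poly int}[n]} -> {mpoly int[n]}} :=
  map_mpoly (horner_eval (1 : int)).
have evX (i : 'I_n) : ev 'X_i = 'X_i by apply: map_mpolyX.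
have evC (a : {poly int}) : ev (mpolyC n a) = mpolyC n a.[1] by apply: map_mpolyC.
have evX1 : ev (mpolyC n 'X) = 1 by rewrite evC hornerX.
have ev_eq : mpolyC n V.[1] * alternant (fun i => 'X_i) (part p) =
    \sum_(s in A) mpolyC n (kostka_foulkes p s * V' s).[1] *
      (alternant (fun i => 'X_i) (fun=> 0%N) *
       \sum_(w : 'S_n) \prod_(i < n) 'X_(w i) ^+ part s i).
  have := congr1 ev mpoly_eq; rewrite rmorphM evC rmorph_alternant.
  rewrite (eq_alternant _ evX) => ->; rewrite rmorph_sum; apply: eq_bigr => s _.
  rewrite rmorphM evC rmorph_hl_numerator evX1 (eq_hl_numerator _ _ evX).
  by rewrite hl_numerator1.
have V1_neq0 : V.[1] != 0.
  rewrite horner_prod; apply/prodf_neq0 => s _.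
  by rewrite horner_vpart1 Num.Theory.pnatr_eq0 -lt0n; apply: prodn_gt0 => a; apply: fact_gt0.
apply: (mulfI V1_neq0).
transitivity (\sum_(s in A) (kostka_foulkes p s * V' s).[1] *
   \sum_(w : 'S_n | jt_valid r w)
    (-1) ^+ w * ((partition_of (jt_comp r w) == s)%:R * (vpart n s).[1])).
  rewrite mulr_sumr; under [RHS]eq_bigr do rewrite mulr_sumr.
  rewrite exchange_big; apply: eq_bigr => w valid_w.
  set q := partition_of _.
  have weight_q : weight q = m.
    by rewrite weight_partition_of sumn_jt_comp.
  have le_qm : (weight q <= m)%N by rewrite weight_q.
  have le_qn : (size q <= n)%N.
    rewrite /= size_sort size_filter (leq_trans (count_size _ _)) //.
    by rewrite size_map size_enum_ord.
  rewrite (bigD1 (BoundedPartition le_qm)) /=; last by rewrite inE /= weight_q eqxx.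
  rewrite eqxx big1 ?addr0 => [|s /andP[_ neq_s]]; last first.
    by rewrite -val_eqE /= eq_sym in neq_s; rewrite (negPf neq_s) mul0r !mulr0.
  have rearrange (v v' k e : int) : v * v' * (e * k) = k * v' * (e * (1 * v)) by ring.
  by rewrite (VE (BoundedPartition le_qm)) !hornerM rearrange.
have /esym := congr1 (mcoeff (delta_shift n r)) ev_eq.
rewrite mcoeffCM (mcoeff_alternant_shift _ le_pn le_rn) (raddf_sum (mcoeff _)) => /= <-.
apply: eq_bigr => s /andP[_ le_sn].
by rewrite mcoeffCM mcoeff_alternant_monomials.
Qed.

(** * The fermionic formula *)

Section KostkaSum.

Variables (m n : nat).

Let A := [pred p : bounded_partition m | (weight p == m) && (size p <= n)%N].

Lemma sum_pick_partition (R : pzRingType) (p : intpart) (G : intpart -> R) :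
  weight p = m -> (size p <= n)%N ->
  \sum_(j < #|A|) (p == enum_val j)%:R * G (enum_val j) = G p.
Proof.
move=> weight_p le_pn; have le_pm : (weight p <= m)%N by rewrite weight_p.
transitivity (\sum_(s in A) (p == s :> intpart)%:R * G s).
  by rewrite [RHS]big_enum_val.
rewrite (bigD1 (BoundedPartition le_pm)) /=; last by rewrite inE /= weight_p eqxx.
rewrite eqxx mul1r big1 ?addr0 // => s /andP[_ neq_s].
by rewrite -val_eqE /= eq_sym in neq_s; rewrite (negPf neq_s) mul0r.
Qed.

(** The matrix $J$. A composition [jt_comp p w] with [w] in $S_n$ has [n] components, so its
    partition has at most [n] parts: rows and columns can both be indexed by [A]. *)
Definition jt_matrix : 'M[int]_#|A| :=
  \matrix_(i < #|A|, j < #|A|) \sum_(w : 'S_n | jt_valid (enum_val i) w)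
    (-1) ^+ w * (partition_of (jt_comp (enum_val i) w) == enum_val j)%:R.

Definition kostka_matrix : 'M[int]_#|A| :=
  \matrix_(i < #|A|, j < #|A|) (kostka_foulkes (enum_val i) (enum_val j)).[1].

Lemma size_partition_of_comp (p : intpart) (w : 'S_n) :
  (size (partition_of (jt_comp p w)) <= n)%N.
Proof.
rewrite /= size_sort size_filter (leq_trans (count_size _ _)) //.
by rewrite size_map size_enum_ord.
Qed.

Lemma kostka_jt_matrix : kostka_matrix *m jt_matrix^T = 1%:M.
Proof.
apply/matrixP => i k; rewrite !mxE.
have /andP[/eqP weight_i le_in] : enum_val i \in A by apply: enum_valP.
have /andP[/eqP weight_k le_kn] : enum_val k \in A by apply: enum_valP.
transitivity ((enum_val i == enum_val k)%:R : int); last first.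
  by rewrite (inj_eq enum_val_inj).
rewrite -(kostka_foulkes_inverse weight_i weight_k le_in le_kn).
transitivity (\sum_(w : 'S_n | jt_valid (enum_val k) w) \sum_(j < #|A|) (-1) ^+ w *
   ((partition_of (jt_comp (enum_val k) w) == enum_val j)%:R *
    (kostka_foulkes (enum_val i) (enum_val j)).[1])).
  rewrite exchange_big; apply: eq_bigr => j _; rewrite !mxE mulr_sumr.
  by apply: eq_bigr => w _; rewrite mulrCA (mulrC _ _.[1]).
apply: eq_bigr => w valid_w; rewrite -mulr_sumr; congr (_ * _).
apply: (sum_pick_partition (fun s => (kostka_foulkes (enum_val i) s).[1])).
  by rewrite weight_partition_of sumn_jt_comp.
exact: size_partition_of_comp.
Qed.

(** The identity $K(1)^TK(q)=K(1)^TJA(q)=A(q)$, read in the row of the partition of $\lambda$ and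
    the column of $\mu$; here [f] is that column of $A(q)$. *)
Lemma sum_kostka (lam : seq nat) (mu : intpart) : size lam = n -> sumn lam = m ->
  weight mu = m ->
  \sum_(eta : bounded_partition m | (weight eta == m) && (size eta <= n)%N)
    (kostka eta lam)%:P * kostka_foulkes eta mu =
  fermionic m lam (conj_partition mu).
Proof.
move=> size_lam sum_lam weight_mu.
pose f (s : intpart) := fermionic m s (conj_partition mu).
have weight_p : weight (partition_of lam) = m by rewrite weight_partition_of.
have le_pm : (weight (partition_of lam) <= m)%N by rewrite weight_p.
have le_pn : (size (partition_of lam) <= n)%N.
  by rewrite /= size_sort size_filter (leq_trans (count_size _ _)) ?size_lam.
pose bp : bounded_partition m := BoundedPartition le_pm.
have A_bp : bp \in A by rewrite inE /= weight_p eqxx.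
pose k := enum_rank_in A_bp bp.
have kE : enum_val k = bp by rewrite enum_rankK_in.
have KF (i : 'I_#|A|) : kostka_foulkes (enum_val i) mu =
    \sum_(j < #|A|) (jt_matrix i j)%:P * f (enum_val j).
  have /andP[/eqP weight_i le_in] : enum_val i \in A by apply: enum_valP.
  rewrite (kostka_foulkes_jt weight_i weight_mu le_in) /jt_coef weight_i.
  transitivity (\sum_(w : 'S_n | jt_valid (enum_val i) w) \sum_(j < #|A|)
     (-1) ^+ w * ((partition_of (jt_comp (enum_val i) w) == enum_val j)%:R *
       f (enum_val j))).
    apply: eq_bigr => w valid_w; rewrite -mulr_sumr; congr (_ * _).
    have weight_w : weight (partition_of (jt_comp (enum_val i) w)) = m.
      by rewrite weight_partition_of sumn_jt_comp.
    rewrite (sum_pick_partition f weight_w (size_partition_of_comp _ _)).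
    by rewrite /f fermionic_sorted // sumn_jt_comp.
  rewrite exchange_big; apply: eq_bigr => j _; rewrite mxE rmorph_sum mulr_suml.
  by apply: eq_bigr => w _; rewrite mulrA rmorphM rmorph_sign rmorph_nat.
transitivity (\sum_(i < #|A|) (kostka_matrix i k)%:P * kostka_foulkes (enum_val i) mu).
  transitivity (\sum_(s in A) (kostka_foulkes s bp).[1]%:P * kostka_foulkes s mu).
    by [].
  by rewrite big_enum_val; apply: eq_bigr => i _; rewrite mxE kE.
under eq_bigr do rewrite KF mulr_sumr.
rewrite exchange_big -(fermionic_sorted sum_lam weight_mu) -[RHS]/(f bp) -kE.
transitivity (\sum_(j < #|A|) ((jt_matrix^T *m kostka_matrix) j k)%:P * f (enum_val j)).
  apply: eq_bigr => j _; rewrite mxE rmorph_sum mulr_suml; apply: eq_bigr => i _.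
  by rewrite [_^T j i]mxE rmorphM mulrA; congr (_ * _); apply: mulrC.
(* A one-sided inverse of a square matrix over a commutative ring is two-sided, which turns
   $K(1)J^T=1$ into $J^TK(1)=1$. *)
rewrite (mulmx1C kostka_jt_matrix) (bigD1 k) //= !mxE eqxx mul1r.
by rewrite big1 ?addr0 // => j neq_jk; rewrite mxE (negPf neq_jk) mul0r.
Qed.

End KostkaSum.

Lemma hstrip_prod (R : comNzRingType) (q : R) a c : size a = size c ->
  hstrip q a c = \prod_(0 <= i < size a)
    (if (nth 0%N a i <= nth 0%N c i)%N then
       q ^+ 'C(nth 0%N c i - nth 0%N a i, 2) *
       gauss q (nth 0%N c i - nth 0%N a i.+1) (nth 0%N a i - nth 0%N a i.+1)
     else 0).
Proof.
elim: a c => [|h a IHa] [|k c] //= size_ac; first by rewrite big_nil.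
by rewrite big_nat_recl //= nth0 IHa //; case: size_ac.
Qed.

Lemma hstrip_pad (R : comNzRingType) (q : R) m (a c : intpart) :
  (weight a <= m)%N -> (weight c <= m)%N ->
  hstrip q (pad m a) (pad m c) = \prod_(0 <= i < m.+1)
    (if (part a i <= part c i)%N then
       q ^+ 'C(part c i - part a i, 2) *
       gauss q (part c i - part a i.+1) (part a i - part a i.+1)
     else 0).
Proof.
move=> le_am le_cm; rewrite hstrip_prod ?size_pad //.
by apply: eq_bigr => i _; rewrite !nth_pad.
Qed.

Lemma includedE (a c : intpart) : included a c = true <-> forall i, (part a i <= part c i)%N.
Proof.
split=> [/forallP inc i | inc]; last by apply/forallP => i; apply: inc.
have [le_ai | lt_ia] := leqP (size a) i; last exact: (inc (Ordinal lt_ia)).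
by rewrite [part a i]nth_default.
Qed.

(** * The iterated Pieri rule as a sum over chains of diagrams *)

Section Flags.

Variable m : nat.

Definition flag k (nu : k.-tuple (bounded_partition m)) (c : intpart) : seq intpart :=
  empty_partition :: rcons (map (@bpart m) nu) c.

Definition flag_step (lam : seq nat) (D : seq intpart) (a : nat) : {poly int} :=
  let b := nth empty_partition D a in let c := nth empty_partition D a.+1 in
  (weight b + nth 0%N lam a == weight c)%N%:R * hstrip 'X (pad m b) (pad m c).

Lemma empty_partitionP (p : intpart) : weight p = 0%N -> p = empty_partition.
Proof.
move=> weight_p; apply: intpart_eq => i; have := part_le_weight p i.
by rewrite weight_p leqn0 => /eqP->; rewrite /part /= nth_nil.
Qed.

(** Here [lam] lists the layers from the innermost outwards, whereas [fermionic] removes the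
    outermost one first; hence [rev]. *)
Lemma fermionic_flags k (lam : seq nat) (c : intpart) : size lam = k.+1 ->
  fermionic m (rev lam) c =
  \sum_(nu : k.-tuple (bounded_partition m))
    \prod_(0 <= a < k.+1) flag_step lam (flag nu c) a.
Proof.
elim: k lam c => [|k IHk] lam c.
  case: lam => [|r []] // _; rewrite [rev _](_ : _ = [:: r]) // fermionic_cons.
  have weight0 : (weight empty_partition <= m)%N by [].
  rewrite [RHS](big_pred1 [tuple]) => [|nu]; last by apply/esym/eqP; apply: tuple0.
  rewrite big_nat1 -[RHS]/((weight empty_partition + r == weight c)%N%:R *
    hstrip 'X (pad m empty_partition) (pad m c)).
  rewrite big_mkcond (bigD1 (BoundedPartition weight0)) // big1 => [|b neq_b].
    rewrite [LHS]addr0 -[fermionic m [::] _]/(1 : {poly int}) mulr1.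
    by rewrite -[bpart _]/empty_partition; case: eqP; rewrite ?mul1r ?mul0r.
  case: eqP => // _; rewrite -[fermionic _ _ _]/((weight b == 0%N)%:R).
  case: eqP => [/empty_partitionP b0|_]; last by rewrite mulr0.
  by case/eqP: neq_b; apply: val_inj.
case/lastP: lam => // lam r; rewrite size_rcons => -[size_lam].
rewrite rev_rcons fermionic_cons.
have rcons_bij : bijective (fun bn : bounded_partition m * k.-tuple (bounded_partition m) =>
    [tuple of rcons bn.2 bn.1] : k.+1.-tuple (bounded_partition m)).
  apply: inj_card_bij; last by rewrite card_prod !card_tuple expnS.
  by move=> [b nu] [b' nu'] /= /(congr1 val) /rcons_inj[/val_inj-> ->].
rewrite [RHS](reindex _ (onW_bij _ rcons_bij)) -(pair_bigA _ (fun (b : bounded_partition m)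
    (nu : k.-tuple (bounded_partition m)) =>
  \prod_(0 <= a < k.+2) flag_step (rcons lam r) (flag [tuple of rcons nu b] c) a)) /=.
rewrite big_mkcond; apply: eq_bigr => b _; rewrite (IHk _ _ size_lam) mulr_sumr.
have size_flag (nu : k.-tuple (bounded_partition m)) : size (flag nu b) = k.+2.
  by rewrite /= size_rcons size_map size_tuple.
have flagE (nu : k.-tuple (bounded_partition m)) :
    flag [tuple of rcons nu b] c = rcons (flag nu b) c.
  by rewrite /flag /= map_rcons.
transitivity (\sum_(nu : k.-tuple (bounded_partition m))
    \prod_(0 <= a < k.+1) flag_step lam (flag nu b) a *
    ((weight b + r == weight c)%N%:R * hstrip 'X (pad m b) (pad m c))).
  case: eqP => _; last by rewrite big1 // => nu _; rewrite mul0r mulr0.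
  by apply: eq_bigr => nu _; rewrite mul1r mulrC.
apply: eq_bigr => nu _; rewrite flagE [RHS]big_nat_recr //; apply: congr2.
  rewrite !big_nat; apply: eq_bigr => a /andP[_ lt_ak].
  have lt_ak1 : (a < k.+2)%N by apply: ltnW.
  have lt_ak2 : (a.+1 < k.+2)%N by [].
  by rewrite /flag_step !nth_rcons size_flag size_lam lt_ak lt_ak1 lt_ak2.
have flag_last : nth empty_partition (flag nu b) k.+1 = b.
  by rewrite /flag /= nth_rcons size_map size_tuple ltnn eqxx.
by rewrite /flag_step !nth_rcons size_flag size_lam !ltnn !eqxx ltnSn flag_last.
Qed.

End Flags.

Lemma qpochE k : qpoch k = (1 - 'X) ^+ k * qfact 'X k.
Proof.
elim: k => [|k IHk]; first by rewrite /qpoch big_geq // qfact0 mulr1.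
have -> : qpoch k.+1 = qpoch k * (1 - 'X^(k.+1)) by rewrite /qpoch big_nat_recr.
by rewrite IHk -(qint_geom ('X : {poly int}) k.+1) qfactS exprSr; ring.
Qed.

(** By [qpochE] the two quotients differ only by powers of $1-q$, which cancel since $m=k+(m-k)$. *)
Lemma qbinomE m k : qbinom m k = tofrac (gauss 'X m k).
Proof.
rewrite /qbinom; case: leqP => [le_km | lt_mk]; last by rewrite gauss_small ?rmorph0.
have X1 : 1 - 'X != 0 :> {poly int}.
  rewrite subr_eq0 eq_sym; apply/eqP => /(congr1 (fun p : {poly int} => size p)).
  by rewrite size_polyX size_poly1.
have qpoch_neq0 j : tofrac (qpoch j) != 0.
  by rewrite tofrac_eq0 qpochE mulf_neq0 ?expf_neq0 ?qfact_X_neq0.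
have := gauss_qfact ('X : {poly int}) k (m - k); rewrite subnKC // => E.
apply: (mulIf (mulf_neq0 (qpoch_neq0 k) (qpoch_neq0 (m - k)%N))).
rewrite divfK ?mulf_neq0 // -!rmorphM; congr (tofrac _).
rewrite !qpochE -E -{1}(subnKC le_km) exprD; ring.
Qed.

Lemma sum_tnth_lt n (lam : n.-tuple nat) a : (a <= n)%N ->
  (\sum_(b < n | (b < a)%N) tnth lam b)%N = (\sum_(0 <= b < a) nth 0%N lam b)%N.
Proof.
move=> le_an; rewrite big_mkord (big_ord_widen n) //.
by apply: eq_bigr => b _; rewrite (tnth_nth 0%N).
Qed.

(** * Admissible chains and their weights *)

Section Diagrams.

Variables (k : nat) (mu : intpart) (nu : diagrams k.+1 mu).

Lemma weight_diagram a : (weight (diagram nu a) <= weight mu)%N.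
Proof.
have weight_all : all (fun p => weight p <= weight mu)%N
    (empty_partition :: rcons (map (@bpart _) nu) (conj_partition mu)).
  rewrite /= all_rcons weight_conj leqnn /= all_map.
  by apply/allP => p _; apply: bpartP.
rewrite /diagram; set D := _ :: _.
have [le_Da | lt_aD] := leqP (size D) a; first by rewrite nth_default.
by apply: (allP weight_all); apply: mem_nth.
Qed.

Lemma diagram_last : diagram nu k.+1 = conj_partition mu.
Proof. by rewrite /diagram /= nth_rcons size_map size_tuple ltnn eqxx. Qed.

Lemma flag_stepE (lam : seq nat) a :
  flag_step (weight mu) lam (flag nu (conj_partition mu)) a =
  (weight (diagram nu a) + nth 0%N lam a == weight (diagram nu a.+1))%N%:R *
  \prod_(0 <= i < (weight mu).+1)
    (if (part (diagram nu a) i <= part (diagram nu a.+1) i)%N then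
       'X^'C(part (diagram nu a.+1) i - part (diagram nu a) i, 2) *
       gauss 'X (part (diagram nu a.+1) i - part (diagram nu a) i.+1)
         (part (diagram nu a) i - part (diagram nu a) i.+1)
     else 0).
Proof.
have := @hstrip_pad {poly int} 'X (weight mu) (diagram nu a) (diagram nu a.+1)
  (weight_diagram a) (weight_diagram a.+1).
by move=> <-.
Qed.

Lemma flag_steps_admissible (lam : k.+1.-tuple nat) :
  \prod_(0 <= a < k.+1) flag_step (weight mu) lam (flag nu (conj_partition mu)) a != 0 ->
  admissible lam nu.
Proof.
rewrite big_mkord => /prodf_neq0 step_neq0.
have step (a : nat) : (a < k.+1)%N ->
    weight (diagram nu a.+1) = (weight (diagram nu a) + nth 0%N lam a)%N /\
    forall i, (part (diagram nu a) i <= part (diagram nu a.+1) i)%N.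
  move=> lt_ak; have := step_neq0 (Ordinal lt_ak) isT.
  rewrite flag_stepE mulf_eq0 negb_or => /andP[/=].
  have [eq_w _ | _] := eqVneq (weight (diagram nu a) + nth 0%N lam a)%N
    (weight (diagram nu a.+1)); last by rewrite eqxx.
  rewrite big_mkord => /prodf_neq0 inc; split=> [|i]; first by rewrite eq_w.
  have [lt_im | le_mi] := ltnP i (weight mu).+1.
    by have := inc (Ordinal lt_im) isT; case: ifP; rewrite ?eqxx.
  have -> : part (diagram nu a) i = 0%N; last by [].
  apply/eqP; rewrite part_eq0 (leq_trans (size_le_weight _)) //.
  by rewrite (leq_trans (weight_diagram a)) // ltnW.
apply/andP; split; apply/forallP => a.
  by apply/includedE; case: (step a (ltn_ord a)).
apply/implyP => _; rewrite sum_tnth_lt ?(ltnW (ltn_ord a)) //.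
elim: (a : nat) (ltn_ord a) => [|b IHb] lt_bk; first by rewrite big_geq.
have [-> _] := step b (ltnW lt_bk).
by rewrite big_nat_recr // eqn_add2r; apply: IHb; apply: ltnW.
Qed.

(** Rows from $\mu_1$ on contribute 1, since every diagram lies in $\mu'$, which has $\mu_1$ rows.
    As $\nu^{(0)}$ is empty, the layer [a = 0] contributes a power of $q$ but only trivial
    $q$-binomials. *)
Lemma admissible_flag_steps (lam : k.+1.-tuple nat) : sumn lam = weight mu ->
  admissible lam nu ->
  \prod_(0 <= a < k.+1) flag_step (weight mu) lam (flag nu (conj_partition mu)) a =
  'X^(phi nu) * \prod_(1 <= a < k.+1) \prod_(0 <= i < part mu 0)
    gauss 'X (part (diagram nu a.+1) i - part (diagram nu a) i.+1)
             (part (diagram nu a) i - part (diagram nu a) i.+1).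
Proof.
move=> sum_lam /andP[/forallP inc_nu /forallP weight_nu].
have inc a : (a < k.+1)%N -> forall i, (part (diagram nu a) i <= part (diagram nu a.+1) i)%N.
  by move=> lt_ak; apply/includedE; apply: (inc_nu (Ordinal lt_ak)).
have weightE a : (a <= k.+1)%N ->
    weight (diagram nu a) = (\sum_(0 <= b < a) nth 0%N lam b)%N.
  case: a => [|a] le_ak; first by rewrite big_geq.
  have [lt_ak | ge_ak] := ltnP a.+1 k.+1.
    by have := weight_nu (Ordinal lt_ak); rewrite /= sum_tnth_lt // => /eqP.
  have -> : a = k by lia.
  (* [admissible] prescribes the weights only for $0<a<n$; at $a=n$ the value comes from
     $|\lambda|=|\mu|$. *)
  rewrite diagram_last weight_conj -sum_lam sumnE (big_nth 0%N).
  by rewrite size_tuple.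
have part0 a i : (a <= k.+1)%N -> (part mu 0 <= i)%N -> part (diagram nu a) i = 0%N.
  move=> le_ak le_i; apply/eqP; rewrite -leqn0.
  have : (part (diagram nu k.+1) i <= 0)%N.
    by rewrite diagram_last leqn0 part_eq0 size_mkseq -nth0.
  (* Downward induction along the chain, starting from $\nu^{(n)}=\mu'$. *)
  have [d def_a] : exists d, a = (k.+1 - d)%N by exists (k.+1 - a)%N; lia.
  rewrite {}def_a {le_ak}; elim: d => [|d IHd]; first by rewrite subn0.
  move=> /IHd; apply: leq_trans.
  have [le_kd | lt_dk] := leqP k.+1 d; first by rewrite (_ : k.+1 - d.+1 = k.+1 - d)%N //; lia.
  have -> : (k.+1 - d = (k.+1 - d.+1).+1)%N by lia.
  by apply: inc; lia.
have le_mu0 : (part mu 0 <= (weight mu).+1)%N.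
  by rewrite (leq_trans (part_le_weight _ _)).
have stepE a : (a < k.+1)%N ->
    flag_step (weight mu) lam (flag nu (conj_partition mu)) a =
    'X^(\sum_(0 <= i < part mu 0) 'C(part (diagram nu a.+1) i - part (diagram nu a) i, 2)) *
    \prod_(0 <= i < part mu 0)
      gauss 'X (part (diagram nu a.+1) i - part (diagram nu a) i.+1)
               (part (diagram nu a) i - part (diagram nu a) i.+1).
  move=> lt_ak; rewrite flag_stepE !weightE ?(ltnW lt_ak) // [X in _ == X]big_nat_recr //.
  rewrite eqxx mul1r (@big_cat_nat _ _ _ (part mu 0)) //= [X in _ * X]big1_seq ?mulr1.
    rewrite expr_sum -big_split /=; apply: eq_bigr => i _.
    by rewrite inc.
  move=> i; rewrite mem_index_iota => /andP[_ /andP[le_i _]].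
  by rewrite inc // (part0 a.+1 i) // (part0 a i) ?(ltnW lt_ak) // !sub0n gauss0 mulr1.
transitivity (\prod_(0 <= a < k.+1)
  ('X^(\sum_(0 <= i < part mu 0) 'C(part (diagram nu a.+1) i - part (diagram nu a) i, 2)) *
    \prod_(0 <= i < part mu 0)
      gauss 'X (part (diagram nu a.+1) i - part (diagram nu a) i.+1)
               (part (diagram nu a) i - part (diagram nu a) i.+1) : {poly int})).
  by rewrite !big_nat; apply: eq_bigr => a /andP[_ lt_ak]; apply: stepE.
rewrite big_split -expr_sum; congr (_ * _); rewrite big_ltn //.
rewrite -[RHS]mul1r; congr (_ * _); apply: big1 => i _.
have -> : part (diagram nu 0) i = 0%N by rewrite /diagram /part /= nth_nil.
by rewrite sub0n gauss0.
Qed.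

End Diagrams.

Theorem proposition4p1 (n : nat) (hn : (2 <= n)%N)
    (mu : intpart) (lam : n.-tuple nat) (hlam : sumn lam = weight mu) :
  tofrac (\sum_(eta : bounded_partition (weight mu) |
                  (weight eta == weight mu) && (size eta <= n)%N)
            (kostka eta lam)%:P * kostka_foulkes eta mu) =
  \sum_(nu : diagrams n mu | admissible lam nu)
    tofrac ('X^(phi nu)) *
    \prod_(1 <= a < n) \prod_(0 <= i < part mu 0)
      qbinom (part (diagram nu a.+1) i - part (diagram nu a) i.+1)
             (part (diagram nu a) i - part (diagram nu a) i.+1).
Proof.
case: n hn lam hlam => [//|k] _ lam hlam.
(* The factors $h_{\lambda_i}$ commute, so $\lambda$ may be reversed; $\lambda_1$ then becomes the
   size of the innermost layer $\nu^{(1)}$. *)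
rewrite (sum_kostka (size_tuple lam) hlam erefl) -(fermionic_rev hlam erefl).
rewrite (fermionic_flags _ _ (size_tuple lam)) rmorph_sum [RHS]big_mkcond.
apply: eq_bigr => nu _; case: ifP => [adm_nu | not_adm].
  rewrite (admissible_flag_steps hlam adm_nu) rmorphM rmorph_prod; congr (_ * _).
  apply: eq_bigr => a _; rewrite rmorph_prod; apply: eq_bigr => i _.
  by rewrite qbinomE.
apply/eqP; rewrite tofrac_eq0; apply: contraFT not_adm.
exact: flag_steps_admissible.
Qed.
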